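(* Let $m,n\ge 1$ be integers, let $A_i,B_i\in\mathbb{P}_n$ for all $i=1,\dots,m$, and let $p>0$ and $r\ge 1$ be real numbers such that $rp\ge 1$. Let $Z=[Z_{ij}]\in\mathbb{M}_{mn}(\mathbb{C})$ be the $m\times m$ block matrix with blocks $Z_{ij}=B_i^{1/2}\left(\sum_{k=1}^m A_k\right)B_j^{1/2}\in\mathbb{M}_n(\mathbb{C})$ for all $i,j=1,\dots,m$. Then for all unitarily invariant norms $|||\cdot|||$ and for all real $s\ge 2$, $$\left|\left|\left|\sum_{i=1}^m\left(A_i^{s}\sharp B_i^{s}\right)^r\right|\right|\right|\le\left|\left|\left|Z^{\frac{sr}{2}}\right|\right|\right|\le\left|\left|\left|\left(\left(\sum_{i=1}^mA_i\right)^{\frac{srp}{4}}\left(\sum_{i=1}^mB_i\right)^{\frac{srp}{2}}\left(\sum_{i=1}^mA_i\right)^{\frac{srp}{4}}\right)^{\frac{1}{p}}\right|\right|\right|.$$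
   Context: $\mathbb{M}_n(\mathbb{C})$ is the space of $n\times n$ complex matrices and $\mathbb{P}_n\subset\mathbb{M}_n(\mathbb{C})$ is the set of (Hermitian) positive definite matrices. For $A,B\in\mathbb{P}_n$ the geometric mean is $A\sharp B=A^{1/2}\left(A^{-1/2}BA^{-1/2}\right)^{1/2}A^{1/2}$. Real powers of positive (semi)definite matrices are taken via the spectral functional calculus; the matrix $Z$ is positive semidefinite. A unitarily invariant norm is a norm with $|||UAV|||=|||A|||$ for all matrices $A$ and unitary $U,V$. Convention for comparing matrices of different sizes: $|||\cdot|||$ is a unitarily invariant norm on $\mathbb{M}_{mn}(\mathbb{C})$, and for $A\in\mathbb{M}_n(\mathbb{C})$ one sets $|||A|||=|||A\oplus 0|||$, where $A\oplus 0\in\mathbb{M}_{mn}(\mathbb{C})$ is the block diagonal matrix with $A$ as its first diagonal block and zeros elsewhere. *)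

(* Defs.v *)
From HB Require Import structures.
From mathcomp Require Import all_boot all_order all_algebra.
From mathcomp Require Import complex.
From mathcomp Require Import reals exp.

Set Implicit Arguments.
Unset Strict Implicit.
Unset Printing Implicit Defensive.

Import Order.TTheory GRing.Theory Num.Theory.
Local Open Scope ring_scope.
Local Open Scope sesquilinear_scope.
Local Open Scope complex_scope.

Definition posdefmx (R : realType) (n : nat) (A : 'M[R[i]]_n) : Prop :=
  A \is hermsymmx /\
  forall x : 'cV[R[i]]_n, x != 0 -> 0 < (x^t* *m A *m x) 0 0.

(* Spectral functional calculus for [f : R -> R], applied to a diagonalization
   [A = U^-1 *m diag_mx d *m U] with [U] unitary ([orthomx_spectralP]).
   Meaningful for Hermitian [A]: then [d] is real, so that taking real parts
   loses nothing, and the result does not depend on the diagonalization. *)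
Definition mxcalc (R : realType) (n : nat) (f : R -> R) (A : 'M[R[i]]_n) :
    'M[R[i]]_n :=
  invmx (spectralmx A)
    *m diag_mx (map_mx (fun z => (f (complex.Re z))%:C) (spectral_diag A))
    *m spectralmx A.

(* [0 `^ t = 0] for [t != 0], so that for [t > 0] this is also the usual power
   of a singular positive semidefinite matrix. *)
Definition mxpowR (R : realType) (n : nat) (A : 'M[R[i]]_n) (t : R) :
    'M[R[i]]_n :=
  mxcalc (fun x => x `^ t) A.

Definition geomean (R : realType) (n : nat) (A B : 'M[R[i]]_n) : 'M[R[i]]_n :=
  mxpowR A (1 / 2)
    *m mxpowR (mxpowR A (- (1 / 2)) *m B *m mxpowR A (- (1 / 2))) (1 / 2)
    *m mxpowR A (1 / 2).

(* [`|a|] lives in [R[i]] (with zero imaginary part), hence the real part. *)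
Record unitarily_invariant_norm (R : realType) (k : nat)
    (N : 'M[R[i]]_k -> R) : Prop := UnitarilyInvariantNorm {
  uinorm_ge0 : forall A, 0 <= N A;
  uinorm_eq0 : forall A, N A = 0 -> A = 0;
  uinormZ : forall (a : R[i]) A, N (a *: A) = complex.Re `|a| * N A;
  uinormD : forall A B, N (A + B) <= N A + N B;
  uinormU : forall A U V, U \is unitarymx -> V \is unitarymx ->
    N (U *m A *m V) = N A }.

(* [A (+) 0] as an m x m block matrix with n x n blocks. The size
   [\sum_(i < m) n] is the one produced by [\mxblock]; it equals [m * n]. *)
Definition pad0 (R : realType) (m n : nat) (A : 'M[R[i]]_n) :
    'M[R[i]]_(\sum_(i < m) n) :=
  \mxblock_(i < m, j < m)
    (if (val i == 0%N) && (val j == 0%N) then A else 0 : 'M[R[i]]_n).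

Definition blockZ (R : realType) (m n : nat) (A B : 'I_m -> 'M[R[i]]_n) :
    'M[R[i]]_(\sum_(i < m) n) :=
  \mxblock_(i < m, j < m)
    (mxpowR (B i) (1 / 2) *m (\sum_(k < m) A k) *m mxpowR (B j) (1 / 2)).

(* Main.v *)
Require Import Defs.
From HB Require Import structures.
From mathcomp Require Import all_boot all_order all_algebra.
From mathcomp Require Import complex.
From mathcomp Require Import reals exp.
From mathcomp Require Import boolp.
From mathcomp Require Import perm lra ring.

Set Implicit Arguments.
Unset Strict Implicit.
Unset Printing Implicit Defensive.

Import Order.TTheory GRing.Theory Num.Theory.
Local Open Scope ring_scope.
Local Open Scope sesquilinear_scope.
Local Open Scope complex_scope.

(** Write [X^*] for the adjoint and [sv X] for the decreasing sequence of
    singular values. By Ky Fan's dominance principle ([uinorm_dominance]) a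
    unitarily invariant norm is monotone in the partial sums of [sv], so both
    inequalities are statements about such sums, for square matrices of the
    full block size. There, with block diagonal [A] and [B] and with [F] the
    block matrix whose first block row consists of identities, [F X F^*] is the
    padded sum of the blocks of a block diagonal [X], and [Z = K K^*] for
    [K = B^(1/2) F^* F A^(1/2)].

    Partial products of singular values are easier than partial sums: the
    product of the first [k] of them is the norm of the [k]-th exterior power,
    here described by Gram determinants of [k]-frames. It is submultiplicative
    ([prodsvM]) and cyclic ([prodsv_cyclic]): if [X Y] is positive, its products
    are at most those of [Y X]. Comparison of partial products implies
    comparison of partial sums of powers ([sum_powR_le_of_prod_le]). The only
    analytic input is the Araki-Cordes inequality [araki_cordes], which bounds
    the products of [P^t Q^t] by the [t]-th power of those of [P Q].

    For the second inequality, [Z = T^* T] and [T T^* = P^(1/2) Q P^(1/2)], where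
    [P] and [Q] are the padded sums of the [A_i] and of the [B_i]; hence
    Araki-Cordes with exponent [2 / (s r p) <= 1] suffices ([sum_sv_araki]).

    For the first one, let [G = A^s # B^s]. By polar decomposition
    [G = A^(s/2) W B^(s/2)] with [W] unitary, so [G = A^(1/2) D B^(1/2)] with
    [D = A^((s-1)/2) W B^((s-1)/2)], and Araki-Cordes bounds the products of [D]
    by the power [(s-1)/s] of those of [G] ([prodsv_gmean_factor]). Let
    [S = F G F^*], the padded sum of the blocks of [G]. Cyclicity gives
    [prodsv k S <= prodsv k D * prodsv k K]. Conversely the partial sums of [G]
    are at most those of [S], because [G] is a pinching of
    [G^(1/2) F^* F G^(1/2)], which has the singular values of [S]
    ([sum_sv_pinching]). Thus [S] is estimated by a power of itself and by
    [K], and Young's inequality absorbs the power of [S] into the left-hand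
    side: the sums of [sv S ^ r] are at most those of [sv K ^ (s r)], that is of
    [sv Z ^ (s r / 2)]. The same absorption, applied to
    [F G^r F^* = F G^(1/2) G^(r-1) G^(1/2) F^*], bounds the sums of the singular
    values of this matrix by those of [sv S ^ r] ([sum_sv_geomean]). *)

(** * Sequences of nonnegative reals: majorization *)

Section Majorization.
Variable R : realType.
Implicit Types (x y z w c d : nat -> R) (k : nat).

Definition decreasing_seq x := forall i j, (i <= j)%N -> x j <= x i.

(** Young's inequality, in the shape in which it absorbs a factor back into
    the quantity that is being estimated. *)
Lemma young_powR (u v q : R) : 0 <= u -> 0 <= v -> 1 <= q ->
  q * (u `^ (q - 1) * v) <= (q - 1) * u `^ q + v `^ q.
Proof.
move=> u0 v0; rewrite le_eqVlt => /predU1P[<-|q1].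
  by rewrite subrr powRr0 !mul1r mul0r add0r powRr1.
have q0 : 0 < q by apply: lt_trans q1.
have q10 : 0 < q - 1 by rewrite subr_gt0.
have := @conjugate_powR R (u `^ (q - 1)) v (q / (q - 1)) q (powR_ge0 _ _) v0.
rewrite divr_gt0// => /(_ isT q0).
have -> : (q / (q - 1))^-1 + q^-1 = 1 by field; rewrite !gt_eqF.
move=> /(_ erefl); rewrite -powRrM mulrCA divff ?gt_eqF// mulr1.
move=> /(ler_wpM2l (ltW q0)) /le_trans; apply.
by rewrite le_eqVlt; apply/orP; left; apply/eqP; field; rewrite !gt_eqF.
Qed.

(** Summation by parts. *)
Lemma abel_sum_ge0 w z k : decreasing_seq w -> (forall j, 0 <= w j) ->
  (forall l, (l <= k)%N -> 0 <= \sum_(j < l) z j) ->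
  0 <= \sum_(j < k) w j * z j.
Proof.
move=> wd w0 zk.
suff: forall l, (l < k)%N -> w l * \sum_(j < l.+1) z j <=
    \sum_(j < l.+1) w j * z j.
  case: k zk => [|k] zk H; first by rewrite big_ord0.
  by apply: le_trans (H k _) => //; rewrite mulr_ge0// zk.
elim=> [|l IH] lk; first by rewrite !big_ord1.
rewrite big_ord_recr [leRHS]big_ord_recr /= mulrDr lerD2r.
apply: le_trans (IH (ltnW lk)); apply: ler_wpM2r; first by apply: zk; apply: ltnW.
exact: wd.
Qed.

(** The tangent line of [u ^ r] at [u = x j], which is Young's inequality,
    turns the claim into a sum by parts with the decreasing weights
    [x j ^ (r - 1)]. *)
Lemma sum_powR_le x y (k : nat) (r : R) : decreasing_seq x ->
  (forall j, 0 <= x j) -> (forall j, 0 <= y j) -> 1 <= r ->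
  (forall l, (l <= k)%N -> \sum_(j < l) x j <= \sum_(j < l) y j) ->
  \sum_(j < k) x j `^ r <= \sum_(j < k) y j `^ r.
Proof.
move=> xd x0 y0 r1 xy; rewrite -subr_ge0 -sumrB.
have r0 : 0 < r by apply: lt_le_trans r1.
have H : 0 <= \sum_(j < k) x j `^ (r - 1) * (y j - x j).
  apply: (@abel_sum_ge0 (fun j => x j `^ (r - 1)) (fun j => y j - x j)) => //.
  - by move=> i j ij; apply: ge0_ler_powR; rewrite ?nnegrE ?subr_ge0// xd.
  - by move=> j; apply: powR_ge0.
  - by move=> l lk; rewrite sumrB subr_ge0; apply: xy.
have {}H : 0 <= r * \sum_(j < k) x j `^ (r - 1) * (y j - x j).
  by rewrite mulr_ge0// ltW.
apply: le_trans H _; rewrite mulr_sumr; apply: ler_sum => j _.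
have := young_powR (x0 j) (y0 j) r1; have := mulr_powRB1 (x0 j) r0.
set a := x j `^ r; set b := x j `^ _; move=> <-.
by lra.
Qed.

(** The tangent line of [exp] turns a comparison of partial products into
    one of partial sums weighted by [x]. *)
Lemma sum_le_of_prod_le x y k : decreasing_seq x ->
  (forall j, 0 <= x j) -> (forall j, 0 <= y j) ->
  (forall l, (l <= k)%N -> \prod_(j < l) x j <= \prod_(j < l) y j) ->
  \sum_(j < k) x j <= \sum_(j < k) y j.
Proof.
move=> xd x0 y0; elim: k => [|k IH] xy; first by rewrite !big_ord0.
have [xk0|xk0] := eqVneq (x k) 0.
  rewrite !big_ord_recr /= xk0 lerD// IH// => l lk.
  by apply: xy; apply: leqW.
have xp j : (j <= k)%N -> 0 < x j.
  by move=> jk; apply: lt_le_trans (xd _ _ jk); rewrite lt_def xk0 x0.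
have yp j : (j <= k)%N -> 0 < y j.
  move=> jk; rewrite lt_def y0 andbT.
  have : 0 < \prod_(i < k.+1) y i.
    apply: lt_le_trans (xy _ (leqnn _)); apply: prodr_gt0 => i _.
    by apply: xp; rewrite -ltnS.
  by move=> /lt0r_neq0 /prodf_neq0 /(_ (Ordinal (jk : (j < k.+1)%N)) isT).
rewrite -subr_ge0 -sumrB.
have H : 0 <= \sum_(j < k.+1) x j * (ln (y j) - ln (x j)).
  apply: (@abel_sum_ge0 x (fun j => ln (y j) - ln (x j))) => // l lk.
  have lnP (u : nat -> R) : (forall j, (j <= k)%N -> 0 < u j) ->
      ln (\prod_(j < l) u j) = \sum_(j < l) ln (u j) /\ 0 < \prod_(j < l) u j.
    move=> up; elim: l lk => [|l IHl] lk; first by rewrite !big_ord0 ln1.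
    have [e p] := IHl (ltnW lk); have ul := up l lk.
    by rewrite !big_ord_recr /= lnM ?posrE// e mulr_gt0.
  rewrite sumrB subr_ge0; have [<- px] := lnP x xp; have [<- py] := lnP y yp.
  by rewrite ler_ln ?posrE// xy.
apply: le_trans H _; apply: ler_sum => j _.
have jk : (j <= k)%N by rewrite -ltnS.
have xj := xp j jk; have yj := yp j jk.
rewrite -ln_div ?posrE// mulrC -ler_pdivlMr// mulrBl divff ?gt_eqF//.
have -> : ln (y j / x j) = ln (1 + (y j / x j - 1)) by congr ln; lra.
apply: le_ln1Dx; have : 0 < y j / x j by rewrite divr_gt0.
by lra.
Qed.

Lemma prod_powR x k t : (forall j, 0 <= x j) ->
  \prod_(j < k) x j `^ t = (\prod_(j < k) x j) `^ t.
Proof.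
move=> x0; elim: k => [|k IH]; first by rewrite !big_ord0 powR1.
by rewrite !big_ord_recr /= IH powRM// prodr_ge0.
Qed.

Lemma sum_powR_le_of_prod_le x y k t : decreasing_seq x ->
  (forall j, 0 <= x j) -> (forall j, 0 <= y j) -> 0 <= t ->
  (forall l, (l <= k)%N -> \prod_(j < l) x j <= \prod_(j < l) y j) ->
  \sum_(j < k) x j `^ t <= \sum_(j < k) y j `^ t.
Proof.
move=> xd x0 y0 t0 xy.
apply: (@sum_le_of_prod_le (fun j => x j `^ t) (fun j => y j `^ t)).
- by move=> i j ij; apply: ge0_ler_powR; rewrite ?nnegrE// xd.
- by move=> j; apply: powR_ge0.
- by move=> j; apply: powR_ge0.
- move=> l lk; rewrite !prod_powR//; apply: ge0_ler_powR;
    by rewrite ?nnegrE ?prodr_ge0// xy.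
Qed.

(** In increasing order the [i]-th of [k] distinct indices is at least [i]. *)
Lemma prod_sub_le d (k : nat) (S : seq nat) : decreasing_seq d ->
  (forall j, 0 <= d j) -> uniq S -> size S = k ->
  \prod_(j <- S) d j <= \prod_(j < k) d j.
Proof.
move=> dd d0 uS sS.
have pS : perm_eq (sort geq S) S by rewrite perm_sort.
rewrite -(perm_big _ pS) /=.
have := sort_sorted (fun a b => leq_total b a) S.
have : uniq (sort geq S) by rewrite sort_uniq.
have : size (sort geq S) = k by rewrite size_sort.
elim: k (sort geq S) {pS uS sS} => [|k IH] [|a T]//=.
  by rewrite big_nil big_ord0.
move=> [sT] /andP[aT uT] pT; rewrite big_cons big_ord_recr /= mulrC.
apply: ler_pM => //; first by apply: prodr_ge0.
  by apply: IH => //; apply: path_sorted pT.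
apply: dd; rewrite -sT.
have Ta b : b \in T -> (b < a)%N.
  move=> bT; have := order_path_min (rev_trans leq_trans) pT.
  move=> /allP /(_ b bT); rewrite /geq /= leq_eqVlt => /predU1P[ba|//].
  by rewrite -ba bT in aT.
have := uniq_leq_size uT (s2 := iota 0 a); rewrite size_iota; apply => b bT.
by rewrite mem_iota /= Ta.
Qed.

(** Entries are quotients of consecutive products, and after a vanishing
    product a decreasing nonnegative sequence is 0. *)
Lemma eq_of_prod_eq x y n : decreasing_seq x -> decreasing_seq y ->
  (forall j, 0 <= x j) -> (forall j, 0 <= y j) ->
  (forall k, (k <= n)%N -> \prod_(j < k) x j = \prod_(j < k) y j) ->
  forall j, (j < n)%N -> x j = y j.
Proof.
move=> xd yd x0 y0 xy j jn.
have zero (u : nat -> R) : decreasing_seq u -> (forall i, 0 <= u i) ->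
    \prod_(i < j) u i = 0 -> u j = 0.
  move=> ud u0 /eqP; rewrite prodf_seq_eq0 => /hasP[i _ /= /eqP ui].
  by apply/eqP; rewrite eq_le u0 andbT -ui; apply: ud; apply: ltnW.
have e := xy j (ltnW jn); have := xy _ jn; rewrite !big_ord_recr /= -e.
have [P0|P0] := eqVneq (\prod_(i < j) x i) 0; last by apply: mulfI.
by move=> _; rewrite !zero// -e.
Qed.

(** A weight of total mass [k] with entries at most 1 does best on the first
    [k] entries. *)
Lemma bathtub mu c (n k : nat) : decreasing_seq mu -> (forall j, 0 <= mu j) ->
  (forall j, (j < n)%N -> 0 <= c j <= 1) -> \sum_(j < n) c j = k%:R ->
  \sum_(j < n) mu j * c j <= \sum_(j < k) mu j.
Proof.
move=> mud mu0 c01 ck.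
have kn : (k <= n)%N.
  rewrite -(ler_nat R) -ck; have -> : n%:R = \sum_(j < n) (1 : R).
    by rewrite sumr_const card_ord.
  by apply: ler_sum => j _; have /andP[] := c01 j (ltn_ord j).
have E (u : nat -> R) : \sum_(j < k) u j = \sum_(j < n) (j < k)%:R * u j.
  rewrite (big_ord_widen n u kn) big_mkcond /=.
  by apply: eq_bigr => j _; case: ifP; rewrite ?mul1r ?mul0r.
rewrite E -subr_ge0 -sumrB.
have Z : \sum_(j < n) mu k * ((j < k)%:R - c j) = 0.
  rewrite -mulr_sumr sumrB ck.
  have := E (fun=> 1); rewrite sumr_const card_ord => ->.
  by under [X in X - _]eq_bigr do rewrite -[_%:R]mulr1; rewrite subrr mulr0.
rewrite -[leLHS]Z; apply: ler_sum => j _; have /andP[cj0 cj1] := c01 j (ltn_ord j).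
case: ltnP => jk /=; rewrite ?mul1r ?mul0r ?sub0r.
  have : mu k * (1 - c j) <= mu j * (1 - c j).
    by rewrite ler_wpM2r ?subr_ge0// mud// ltnW.
  by lra.
by rewrite mulrN lerN2 ler_wpM2r// mud.
Qed.

(** Self-improvement: doubling the argument (modulo 1) repeatedly shows that
    [g t ^ (2 ^ n) <= C] for every [n], which no value above 1 satisfies. *)
Lemma halving_le1 (g : R -> R) (C : R) :
  (forall t, 0 <= t <= 1 -> 0 <= g t <= C) ->
  (forall t, 0 <= t -> 2 * t <= 1 -> g t ^+ 2 <= g (2 * t)) ->
  (forall t, t <= 1 -> 1 <= 2 * t -> g t ^+ 2 <= g (2 * t - 1)) ->
  forall t, 0 <= t <= 1 -> g t <= 1.
Proof.
move=> gC g1 g2 t0 t01.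
have pow n t : 0 <= t <= 1 -> g t ^+ (2 ^ n) <= C.
  elim: n t => [|n IH] t t1; first by rewrite expn0 expr1; case/andP: (gC t t1).
  rewrite expnS exprM; have /andP[t_0 t_1] := t1.
  have [h|h] := leP (2 * t) 1.
    have h' : 0 <= 2 * t <= 1 by rewrite mulr_ge0.
    apply: le_trans (IH _ h'); apply: lerXn2r (g1 _ t_0 h);
      rewrite ?nnegrE ?sqr_ge0//; by case/andP: (gC _ h').
  have h' : 0 <= 2 * t - 1 <= 1 by lra.
  apply: le_trans (IH _ h'); apply: lerXn2r (g2 _ t_1 (ltW h));
    rewrite ?nnegrE ?sqr_ge0//; by case/andP: (gC _ h').
rewrite leNgt; apply/negP => gt1.
set e := g t0 - 1; have e0 : 0 < e by rewrite subr_gt0.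
have C0 : 0 <= C by case/andP: (gC _ t01) => a b; apply: le_trans b.
have [n nC] : exists n : nat, C < n%:R * e.
  exists (Num.bound (C / e)); rewrite -ltr_pdivrMr//.
  by apply: le_lt_trans (archi_boundP _); rewrite ?divr_ge0// ltW.
have bern m : 1 + m%:R * e <= g t0 ^+ m.
  elim: m => [|m IH]; first by rewrite mul0r addr0 expr0.
  rewrite exprSr; have ge : g t0 = 1 + e by rewrite /e; lra.
  rewrite ge in IH *.
  apply: le_trans (ler_wpM2r _ IH); last by rewrite addr_ge0// ltW.
  have : 0 <= m%:R * (e * e) by rewrite !mulr_ge0// ltW.
  by rewrite -natr1; lra.
have := pow n _ t01; apply/negP; rewrite -ltNge.
apply: lt_le_trans (bern _); apply: lt_trans nC _.
apply: (@le_lt_trans _ _ ((2 ^ n)%:R * e)).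
  by rewrite ler_wpM2r ?ltW// ltr_nat ltn_expl.
by rewrite ltrDr.
Qed.

End Majorization.

(** * Functional calculus of Hermitian matrices *)

(** A sealed copy of [mxpowR]: two powers of different matrices would
    otherwise be compared by unfolding their diagonalizations. *)
HB.lock Definition powmx (R : realType) (n : nat) (A : 'M[R[i]]_n) (t : R) :
  'M[R[i]]_n := mxpowR A t.

Section FunctionalCalculus.
Variable R : realType.
Local Notation C := R[i].
Implicit Types (m n k : nat) (f g : R -> R) (t u : R).

Lemma adjM m n k (A : 'M[C]_(m, n)) (B : 'M[C]_(n, k)) :
  (A *m B) ^t* = B ^t* *m A ^t*.
Proof. by rewrite trmx_mul map_mxM. Qed.

Lemma adj1 n : (1%:M : 'M[C]_n) ^t* = 1%:M.
Proof. by rewrite trmx1 map_mx1. Qed.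

Lemma unitary_mulVmx n (U : 'M[C]_n) : U \is unitarymx -> U ^t* *m U = 1%:M.
Proof. by move=> /unitarymxP /mulmx1C. Qed.

Lemma adj_unitary n (U : 'M[C]_n) : U \is unitarymx -> U ^t* \is unitarymx.
Proof. by rewrite trmxC_unitary. Qed.

Definition rdiag n (d : 'I_n -> R) : 'M[C]_n := diag_mx (\row_j (d j)%:C).

Lemma rdiagE n (d : 'I_n -> R) i j : rdiag d i j = (d i)%:C *+ (i == j).
Proof. by rewrite !mxE; case: eqVneq => // ->. Qed.

Lemma eq_rdiag n (d e : 'I_n -> R) : d =1 e -> rdiag d = rdiag e.
Proof. by move=> de; apply/matrixP => i j; rewrite !rdiagE de. Qed.

Lemma rdiagM n (d e : 'I_n -> R) :
  rdiag d *m rdiag e = rdiag (fun j => d j * e j).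
Proof.
rewrite mulmx_diag; congr diag_mx; apply/rowP => j.
by rewrite !mxE rmorphM.
Qed.

Lemma conj_realC (x : R) : Num.conj x%:C = x%:C.
Proof. exact: conjc_real. Qed.

Lemma rdiag_adj n (d : 'I_n -> R) : (rdiag d) ^t* = rdiag d.
Proof.
apply/matrixP => i j; rewrite mxE mxE !rdiagE eq_sym.
case: eqVneq => [->|_] /=; rewrite ?mulr0n ?mulr1n;
  [exact: conj_realC|exact: conjC0].
Qed.

Lemma rdiag1 n : rdiag (fun=> 1 : R) = 1%:M :> 'M[C]_n.
Proof. by apply/matrixP => i j; rewrite rdiagE mxE. Qed.

(** A matrix intertwining two Hermitian matrices only couples equal
    eigenvalues, hence intertwines every function of them. *)
Lemma diag_intertwine m n (U : 'M[C]_m) (V : 'M[C]_n) d e (X : 'M[C]_(m, n)) f :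
  U \is unitarymx -> V \is unitarymx ->
  (U ^t* *m rdiag d *m U) *m X = X *m (V ^t* *m rdiag e *m V) ->
  (U ^t* *m rdiag (f \o d) *m U) *m X = X *m (V ^t* *m rdiag (f \o e) *m V).
Proof.
move=> hU hV E.
have hU' := unitary_mulVmx hU; have hV' := unitary_mulVmx hV.
have hU'' := unitarymxP hU; have hV'' := unitarymxP hV.
pose Y := U *m X *m V ^t*.
have XE : X = U ^t* *m Y *m V.
  by rewrite /Y !mulmxA hU' mul1mx -mulmxA hV' mulmx1.
have DY : rdiag d *m Y = Y *m rdiag e.
  have := congr1 (fun M => U *m M *m V ^t*) E.
  rewrite /Y !mulmxA hU'' mul1mx => ->.
  by rewrite -!mulmxA hV'' mulmx1 !mulmxA.
clearbody Y; have FY : rdiag (f \o d) *m Y = Y *m rdiag (f \o e).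
  apply/matrixP => i j; move/matrixP/(_ i j): DY.
  rewrite /rdiag !mul_diag_mx !mul_mx_diag !mxE mulrC.
  have [->|Y0] := eqVneq (Y i j) 0; first by rewrite !mul0r mulr0.
  by move=> /(mulfI Y0) /complexI de /=; rewrite de mulrC.
rewrite XE !mulmxA -[U ^t* *m _ *m U *m _]mulmxA hU'' mulmx1.
rewrite -[U ^t* *m Y *m V *m _]mulmxA hV'' mulmx1.
by rewrite -[_ *m rdiag _ *m Y]mulmxA FY !mulmxA.
Qed.

Definition evals n (H : 'M[C]_n) (j : 'I_n) : R :=
  complex.Re (spectral_diag H 0 j).

Lemma mxcalcE n f (H : 'M[C]_n) : mxcalc f H =
  (spectralmx H) ^t* *m rdiag (f \o evals H) *m spectralmx H.
Proof.
rewrite /mxcalc invmx_unitary; last exact: spectral_unitarymx.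
set D := diag_mx _; have -> // : D = rdiag (f \o evals H).
by congr diag_mx; apply/rowP => j; rewrite [LHS]mxE [RHS]mxE.
Qed.

Local Opaque mxcalc.

Lemma spectralE n (H : 'M[C]_n) : H ^t* = H ->
  H = (spectralmx H) ^t* *m rdiag (evals H) *m spectralmx H.
Proof.
move=> hH; have hh : H \is hermsymmx.
  by apply/is_hermitianmxP; rewrite expr0 scale1r hH.
have := hermitian_spectral_diag_real hh.
have /orthomx_spectralP := hermitian_normalmx hh.
rewrite invmx_unitary; last exact: spectral_unitarymx.
move=> E /mxOverP re; rewrite {1}E.
set D := diag_mx _; have -> // : D = rdiag (evals H).
by congr diag_mx; apply/rowP => j; rewrite [RHS]mxE RRe_real.
Qed.

Lemma mxcalc_intertwine m n f (G : 'M[C]_m) (H : 'M[C]_n) (X : 'M[C]_(m, n)) :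
  G ^t* = G -> H ^t* = H -> G *m X = X *m H ->
  mxcalc f G *m X = X *m mxcalc f H.
Proof.
move=> hG hH; rewrite {1}(spectralE hG) {1}(spectralE hH) !mxcalcE.
by apply: diag_intertwine; apply: spectral_unitarymx.
Qed.

Lemma udiag_herm n (V : 'M[C]_n) d :
  (V ^t* *m rdiag d *m V) ^t* = V ^t* *m rdiag d *m V.
Proof. by rewrite !adjM trmxCK rdiag_adj mulmxA. Qed.

Lemma mxcalc_udiag n f (V : 'M[C]_n) d : V \is unitarymx ->
  mxcalc f (V ^t* *m rdiag d *m V) = V ^t* *m rdiag (f \o d) *m V.
Proof.
move=> hV; set H := _ *m V; rewrite mxcalcE -[RHS]mul1mx -[LHS]mulmx1.
apply: diag_intertwine; [exact: spectral_unitarymx|exact: hV|].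
by rewrite mulmx1 mul1mx -spectralE; last exact: udiag_herm.
Qed.

Lemma mxcalc_herm n f (H : 'M[C]_n) : (mxcalc f H) ^t* = mxcalc f H.
Proof. by rewrite mxcalcE udiag_herm. Qed.

Lemma eq_mxcalc n f g (H : 'M[C]_n) :
  (forall j, f (evals H j) = g (evals H j)) -> mxcalc f H = mxcalc g H.
Proof. by move=> fg; rewrite !mxcalcE (@eq_rdiag _ _ (g \o evals H)). Qed.

Lemma mxcalcM n f g (H : 'M[C]_n) :
  mxcalc f H *m mxcalc g H = mxcalc (fun x => f x * g x) H.
Proof.
rewrite !mxcalcE !mulmxA -[_ *m spectralmx H *m _]mulmxA.
rewrite (unitarymxP (spectral_unitarymx H)) mulmx1.
by rewrite -[_ *m rdiag _ *m rdiag _]mulmxA rdiagM.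
Qed.

Lemma mxcalc_id n (H : 'M[C]_n) : H ^t* = H -> mxcalc id H = H.
Proof. by move=> hH; rewrite mxcalcE -spectralE. Qed.

Lemma mxcalc_cst1 n (H : 'M[C]_n) : mxcalc (fun=> 1) H = 1%:M.
Proof.
rewrite mxcalcE (@eq_rdiag _ _ (fun=> 1))// rdiag1 mulmx1.
by rewrite unitary_mulVmx ?spectral_unitarymx.
Qed.

Lemma mxcalc_comp n f g (H : 'M[C]_n) :
  mxcalc g (mxcalc f H) = mxcalc (g \o f) H.
Proof. by rewrite (mxcalcE f) mxcalc_udiag ?spectral_unitarymx// mxcalcE. Qed.

(** ** Positive matrices *)

(** Positivity is read off the diagonalization on which the functional
    calculus is defined. *)
Definition psd n (H : 'M[C]_n) := H ^t* = H /\ forall j, 0 <= evals H j.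

Definition pd n (H : 'M[C]_n) := H ^t* = H /\ forall j, 0 < evals H j.

Lemma pd_psd n (H : 'M[C]_n) : pd H -> psd H.
Proof. by move=> [hH H0]; split=> // j; apply: ltW. Qed.

Lemma evalsE n (H : 'M[C]_n) (j : 'I_n) : H ^t* = H ->
  (evals H j)%:C = (spectralmx H *m H *m (spectralmx H) ^t*) j j.
Proof.
move=> hH; have hU := unitarymxP (spectral_unitarymx H).
rewrite {3}(spectralE hH) !mulmxA hU mul1mx -mulmxA hU mulmx1.
by rewrite rdiagE eqxx.
Qed.

Lemma gram_ge0 m n (Y : 'M[C]_(m, n)) j : 0 <= (Y ^t* *m Y) j j.
Proof.
by rewrite mxE; apply: sumr_ge0 => i _; rewrite !mxE mulrC mul_conjC_ge0.
Qed.

Lemma psd_gram m n (Y : 'M[C]_(m, n)) : psd (Y ^t* *m Y).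
Proof.
set H := _ *m Y; have hH : H ^t* = H by rewrite adjM trmxCK.
split=> // j; rewrite -ler0c evalsE//.
have -> : spectralmx H *m H *m (spectralmx H) ^t* =
  (Y *m (spectralmx H) ^t*) ^t* *m (Y *m (spectralmx H) ^t*).
  by rewrite adjM trmxCK !mulmxA.
exact: gram_ge0.
Qed.

Lemma psd_congr m n (H : 'M[C]_n) (X : 'M[C]_(n, m)) :
  psd H -> psd (X ^t* *m H *m X).
Proof.
move=> [hH H0]; rewrite (spectralE hH).
have -> : rdiag (evals H) = rdiag (Num.sqrt \o evals H) *m
    rdiag (Num.sqrt \o evals H).
  by rewrite rdiagM; apply: eq_rdiag => j /=; rewrite -expr2 sqr_sqrtr.
set D := rdiag _; set U := spectralmx H.
have -> : X ^t* *m (U ^t* *m (D *m D) *m U) *m X =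
    (D *m U *m X) ^t* *m (D *m U *m X).
  by rewrite !adjM rdiag_adj !mulmxA.
exact: psd_gram.
Qed.

Lemma udiag_psd n (V : 'M[C]_n) d : (forall j, 0 <= d j) ->
  psd (V ^t* *m rdiag d *m V).
Proof.
move=> d0; have -> : rdiag d = (rdiag (Num.sqrt \o d)) ^t* *m
    rdiag (Num.sqrt \o d).
  by rewrite rdiag_adj rdiagM; apply: eq_rdiag => j /=; rewrite -expr2 sqr_sqrtr.
by rewrite -mulmxA -mulmxA mulmxA -adjM; apply: psd_gram.
Qed.

Lemma powmx_psd n (H : 'M[C]_n) t : psd (powmx H t).
Proof. by rewrite powmx.unlock /mxpowR mxcalcE;
apply: udiag_psd => j; apply: powR_ge0. Qed.

Lemma powmx_herm n (H : 'M[C]_n) t : (powmx H t) ^t* = powmx H t.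
Proof. by rewrite powmx.unlock; apply: mxcalc_herm. Qed.

Lemma powmxD n (H : 'M[C]_n) t u : psd H -> 0 <= t -> 0 <= u ->
  powmx H t *m powmx H u = powmx H (t + u).
Proof.
move=> [hH H0] t0 u0; rewrite powmx.unlock /mxpowR mxcalcM; apply: eq_mxcalc => j.
have [tu0|tu0] := eqVneq (t + u) 0; last by rewrite powRD// (negPf tu0).
have t00 : t = 0 by lra.
have u00 : u = 0 by lra.
by rewrite t00 u00 addr0 !powRr0 mulr1.


Qed.

Lemma powmxD_pd n (H : 'M[C]_n) t u : pd H ->
  powmx H t *m powmx H u = powmx H (t + u).
Proof.
move=> [hH H0]; rewrite powmx.unlock /mxpowR mxcalcM; apply: eq_mxcalc => j.
by rewrite powRD//; apply/implyP => _; rewrite gt_eqF.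
Qed.

Lemma powmx1 n (H : 'M[C]_n) : psd H -> powmx H 1 = H.
Proof.
move=> [hH H0]; rewrite -[RHS](mxcalc_id hH) powmx.unlock.
by apply: eq_mxcalc => j; rewrite powRr1.
Qed.

Lemma powmx0 n (H : 'M[C]_n) : powmx H 0 = 1%:M.
Proof.
rewrite -(mxcalc_cst1 H) powmx.unlock.
by apply: eq_mxcalc => j; rewrite powRr0.
Qed.

Lemma powmxM n (H : 'M[C]_n) t u : powmx (powmx H t) u = powmx H (t * u).
Proof.
rewrite powmx.unlock /mxpowR mxcalc_comp; apply: eq_mxcalc => j.
by rewrite /comp powRrM.
Qed.

Lemma pd_unit n (H : 'M[C]_n) : pd H -> H \in unitmx.
Proof.
move=> pH; have := powmxD_pd 1 (-1) pH.
rewrite subrr powmx0 powmx1; last exact: pd_psd.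
by move=> /mulmx1_unit[uH _]; exact: uH.
Qed.

Lemma pd_of_psd_unit n (H : 'M[C]_n) : psd H -> H \in unitmx -> pd H.
Proof.
move=> [hH H0] uH; split=> // j; rewrite lt_def H0 andbT.
apply/negP => /eqP e0; move: uH; rewrite (spectralE hH) !unitmx_mul => /andP[].
move=> /andP[_]; rewrite unitmxE det_diag => D _; move: D.
by rewrite (bigD1 j)//= mxE e0 mul0r unitr0.
Qed.

Lemma pd_gram n (Y : 'M[C]_n) : Y \in unitmx -> pd (Y ^t* *m Y).
Proof.
move=> uY; apply: pd_of_psd_unit; first exact: psd_gram.
by rewrite unitmx_mul uY andbT map_unitmx unitmx_tr.
Qed.

Lemma powmx_pd n (H : 'M[C]_n) t : pd H -> pd (powmx H t).
Proof.
move=> pH; apply: pd_of_psd_unit; first exact: powmx_psd.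
have := powmxD_pd t (- t) pH; rewrite subrr powmx0.
by move=> /mulmx1_unit[uH _]; exact: uH.
Qed.

Lemma posdefmx_pd n (H : 'M[C]_n) : posdefmx H -> pd H.
Proof.
move=> [hh H0]; have hH : H ^t* = H.
  by have := is_hermitianmxP _ _ _ hh; rewrite expr0 scale1r => <-.
split=> // j; rewrite -ltcR evalsE//; set U := spectralmx H.
have := H0 (col j (U ^t*)); rewrite colE adjM trmxCK.
have -> : ((delta_mx j 0 : 'cV[C]_n) ^t* *m U *m H *m (U ^t* *m (delta_mx j 0 : 'cV[C]_n))) 0 0
    = (U *m H *m U ^t*) j j.
  have -> : (delta_mx j 0 : 'cV[C]_n) ^t* = delta_mx 0 j.
    by apply/matrixP => a b; rewrite !mxE andbC rmorph_nat.
  by rewrite !mulmxA -colE -!mulmxA -rowE !mxE.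
apply; apply/eqP => /(congr1 (mulmx U)).
rewrite mulmxA (unitarymxP (spectral_unitarymx H)) mul1mx mulmx0.
by move/matrixP/(_ j 0)/eqP; rewrite !mxE !eqxx oner_eq0.
Qed.

End FunctionalCalculus.

(** * Singular values and Gram determinants of frames *)

Lemma det_mulmx_ffun (K : comPzRingType) k n (A : 'M[K]_(k, n)) (B : 'M[K]_(n, k)) :
  \det (A *m B) = \sum_(f : {ffun 'I_k -> 'I_n})
    (\prod_i A i (f i)) * \det (rowsub f B).
Proof.
rewrite /determinant.
under eq_bigr => s _.
  under eq_bigr => i _ do rewrite mxE.
  rewrite bigA_distr_bigA mulr_sumr; over.
rewrite exchange_big /=; apply: eq_bigr => f _; rewrite mulr_sumr.
apply: eq_bigr => s _; rewrite big_split /= mulrCA; congr (_ * (_ * _)).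
by apply: eq_bigr => i _; rewrite mxE.
Qed.

(** The Cauchy-Binet formula, summed over all maps instead of over subsets:
    each subset of rows is then counted [k`!] times. *)
Lemma cauchy_binet (K : comNzRingType) k n (A : 'M[K]_(k, n)) (B : 'M[K]_(n, k)) :
  (k`!)%:R * \det (A *m B) = \sum_(f : {ffun 'I_k -> 'I_n})
    \det (colsub f A) * \det (rowsub f B).
Proof.
under [RHS]eq_bigr => f _ do rewrite {1}/determinant mulr_suml.
rewrite exchange_big /=.
rewrite -card_Sn -cardsT.
rewrite mulr_natl -sumr_const; apply: eq_big => [s|s _]; first by rewrite !inE.
rewrite det_mulmx_ffun.
rewrite (reindex_inj (h := fun f : {ffun 'I_k -> 'I_n} => [ffun i => f (s i)])) /=;
  last first.
  move=> f g /ffunP fg; apply/ffunP => i.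
  by have := fg (s^-1%g i); rewrite !ffunE permKV.
apply: eq_bigr => f _.
have -> : rowsub [ffun i => f (s i)] B = row_perm s (rowsub f B).
  by apply/matrixP => i j; rewrite !mxE ffunE.
rewrite row_permE det_mulmx det_perm mulrA [_ * (-1) ^+ _]mulrC.
by congr (_ * _ * _); apply: eq_bigr => i _; rewrite mxE ffunE.
Qed.

Section SingularValues.
Variable R : realType.
Local Notation C := R[i].
Implicit Types (m n k : nat) (t : R).
Local Opaque determinant mxcalc.

Definition gdet n k (u : 'M[C]_(n, k)) : C := \det (u ^t* *m u).

Lemma adj_colsub n k (u : 'M[C]_(n, k)) (f : 'I_k -> 'I_n) :
  \det (colsub f (u ^t*)) = Num.conj (\det (rowsub f u)).
Proof.
rewrite -det_tr -det_map_mx; congr (\det _).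
by apply/matrixP => i j; rewrite !mxE.
Qed.

Lemma gdet_ge0 n k (u : 'M[C]_(n, k)) : 0 <= gdet u.
Proof.
have kf : 0 < (k`!)%:R :> C by rewrite ltr0n fact_gt0.
rewrite -(pmulr_rge0 _ kf) /gdet cauchy_binet; apply: sumr_ge0 => f _.
by rewrite adj_colsub mulrC mul_conjC_ge0.
Qed.

Lemma gdet_mulr n k (u : 'M[C]_(n, k)) (l : 'M_k) c : \det l = c%:C ->
  gdet (u *m l) = (c ^+ 2)%:C * gdet u.
Proof.
move=> lc; rewrite /gdet adjM mulmxA -[_ *m u ^t* *m u]mulmxA !det_mulmx.
have -> : \det (l ^t*) = c%:C by rewrite det_map_mx det_tr lc; exact: conj_realC.
by rewrite lc expr2 rmorphM /= mulrAC.
Qed.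

Lemma gdet_unitary n k (V : 'M[C]_n) (u : 'M[C]_(n, k)) :
  V \is unitarymx -> gdet (V *m u) = gdet u.
Proof.
move=> hV; rewrite /gdet adjM mulmxA -[_ *m V ^t* *m V]mulmxA.
by rewrite (unitary_mulVmx hV) mulmx1.
Qed.

(** [k]-frames take the place of vectors: [c] bounds the norm of [M] on
    [k]-fold exterior products, which yields products of [k] singular values
    without exterior powers. *)
Definition gdet_bound n k (M : 'M[C]_n) (c : R) :=
  forall u : 'M[C]_(n, k), gdet (M *m u) <= (c ^+ 2)%:C * gdet u.

Lemma gdet_bound_udiag n k (M V : 'M[C]_n) (d : nat -> R) :
  decreasing_seq d -> (forall j, 0 <= d j) -> V \is unitarymx ->
  M ^t* *m M = V ^t* *m rdiag (fun j => d j ^+ 2) *m V ->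
  gdet_bound k M (\prod_(j < k) d j).
Proof.
move=> dd d0 hV E u; rewrite -(gdet_unitary u hV).
have -> : gdet (M *m u) =
    \det ((V *m u) ^t* *m (rdiag (fun j => d j ^+ 2) *m (V *m u))).
  by rewrite /gdet !adjM -!mulmxA [M ^t* *m _]mulmxA E !mulmxA.
set w := V *m u.
have kf : 0 < (k`!)%:R :> C by rewrite ltr0n fact_gt0.
rewrite -(ler_pM2l kf) [leRHS]mulrCA /gdet !cauchy_binet mulr_sumr.
apply: ler_sum => f _; rewrite adj_colsub.
have -> : rowsub f (rdiag (fun j : 'I_n => d j ^+ 2) *m w) =
    rdiag (fun i => d (f i) ^+ 2) *m rowsub f w.
  by apply/matrixP => i j; rewrite /rdiag !mul_diag_mx !mxE.
rewrite det_mulmx mulrCA.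
have [fi|/injectiveP fi] := altP (injectiveP f); last first.
  have [i [j [ij fij]]] : exists i, exists j, i != j /\ f i = f j.
    move/injectiveP: fi => /injectivePn[i [j ij fij]].
    by exists i, j.
  rewrite (_ : \det (rowsub f w) = 0) ?mulr0//.
  apply: (determinant_alternate ij) => l.
  by rewrite !mxE fij.
apply: ler_wpM2r; first by rewrite mulrC mul_conjC_ge0.
have -> : \det (rdiag (fun i => d (f i) ^+ 2)) = ((\prod_i d (f i)) ^+ 2)%:C.
  rewrite det_diag -prodrXl rmorph_prod; apply: eq_bigr => i _.
  by rewrite mxE.
rewrite lecR; apply: lerXn2r; rewrite ?nnegrE ?prodr_ge0//.
have -> : \prod_i d (f i) = \prod_(j <- [seq val (f i) | i <- enum 'I_k]) d j.
  by rewrite big_map big_enum.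
apply: prod_sub_le => //; last by rewrite size_map size_enum_ord.
by rewrite map_inj_uniq ?enum_uniq// => i j /val_inj /fi.
Qed.

(** ** Sorted spectral theorem *)

Definition sorted_evals n (H : 'M[C]_n) (j : nat) : R :=
  nth 0 (sort >=%O [seq evals H i | i <- enum 'I_n]) j.

Lemma sorted_evals_psd n (H : 'M[C]_n) : psd H ->
  [/\ decreasing_seq (sorted_evals H), (forall j, 0 <= sorted_evals H j) &
  exists2 V : 'M[C]_n, V \is unitarymx & H = V ^t* *m rdiag (sorted_evals H) *m V].
Proof.
move=> [hH H0]; rewrite /sorted_evals.
set e := [seq _ | _ <- _]; have se : size e = n by rewrite size_map size_enum_ord.
have s0 j : 0 <= nth 0 (sort >=%O e) j.
  have [jn|jn] := ltnP j (size (sort >=%O e)); last by rewrite nth_default.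
  have := mem_nth 0 jn; rewrite mem_sort => /mapP[i _ ->]; exact: H0.
split=> //.
  move=> i j ij; have [jn|jn] := ltnP j (size (sort >=%O e)); last first.
    by rewrite [X in X <= _]nth_default.
  have tr : transitive (>=%O : rel R) by move=> a b c /= ba cb; apply: le_trans ba.
  have srt : sorted >=%O (sort >=%O e).
    by apply: sort_sorted => a b; rewrite le_total.
  by have := sorted_leq_nth tr (@lexx _ R) 0 srt; apply => //; apply: leq_ltn_trans jn.
have [p pe] : exists p : 'S_n, forall j : 'I_n,
    nth 0 (sort >=%O e) j = evals H (p j).
  have /tuple_permP[p E] : perm_eq (sort >=%O e) [tuple evals H i | i < n].
    by rewrite perm_sort.
  exists p => j; rewrite E -(tnth_nth 0 [tuple _ | i < n]) !tnth_mktuple.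
  by [].
have pU : (perm_mx p : 'M[C]_n) ^t* *m perm_mx p = 1%:M.
  by rewrite tr_perm_mx map_perm_mx -perm_mxM mulVg perm_mx1.
exists (perm_mx p *m spectralmx H).
  apply: mul_unitarymx (spectral_unitarymx H).
  by apply/unitarymxP/mulmx1C.
have E : rdiag (fun j => nth 0 (sort >=%O e) j) *m perm_mx p =
    perm_mx p *m rdiag (evals H).
  apply/matrixP => i j; rewrite /rdiag mul_diag_mx mul_mx_diag !mxE pe.
  by case: eqVneq => [->|_]; rewrite ?mulr0 ?mul0r// mulrC.
rewrite adjM !mulmxA -[_ *m rdiag _ *m _]mulmxA E mulmxA.
rewrite -[_ *m _ *m perm_mx p]mulmxA pU mulmx1.
exact: spectralE.
Qed.

(** The singular values of [M], in decreasing order and continued by 0. *)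
Definition sv n (M : 'M[C]_n) (j : nat) : R :=
  Num.sqrt (sorted_evals (M ^t* *m M) j).

(** The norm of the [k]-th exterior power of [M]. *)
Definition prodsv k n (M : 'M[C]_n) : R := \prod_(j < k) sv M j.

End SingularValues.

(** ** Partial products of singular values *)

Section SingularValueTheory.
Variable R : realType.
Local Notation C := R[i].
Implicit Types (m n k : nat) (t : R).
Local Opaque determinant mxcalc.

Lemma sv_udiag n (M : 'M[C]_n) : exists2 V : 'M[C]_n, V \is unitarymx &
  M ^t* *m M = V ^t* *m rdiag (fun j => sv M j ^+ 2) *m V.
Proof.
have [_ d0 [V hV E]] := sorted_evals_psd (psd_gram M).
exists V; first exact: hV.
rewrite {1}E; congr (_ *m _ *m _).
by apply: eq_rdiag => j; rewrite sqr_sqrtr.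
Qed.

Lemma sv_ge0 n (M : 'M[C]_n) j : 0 <= sv M j.
Proof. exact: sqrtr_ge0. Qed.

Lemma sv_dec n (M : 'M[C]_n) : decreasing_seq (sv M).
Proof.
have [dd _ _] := sorted_evals_psd (psd_gram M).
by move=> i j ij; apply: ler_wsqrtr; apply: dd.
Qed.

Lemma sv_out n (M : 'M[C]_n) j : (n <= j)%N -> sv M j = 0.
Proof.
move=> nj; rewrite /sv /sorted_evals nth_default ?sqrtr0//.
by rewrite size_sort size_map size_enum_ord.
Qed.

Lemma sv_eq_gram n (M M' : 'M[C]_n) : M ^t* *m M = M' ^t* *m M' ->
  sv M =1 sv M'.
Proof. by move=> E j; rewrite /sv E. Qed.

Lemma prodsvE k n (M : 'M[C]_n) : prodsv k M = \prod_(j < k) sv M j.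
Proof. by []. Qed.

Lemma prodsv_ge0 k n (M : 'M[C]_n) : 0 <= prodsv k M.
Proof. by apply: prodr_ge0 => j _; apply: sv_ge0. Qed.

Lemma eq_prodsv k n (M M' : 'M[C]_n) : sv M =1 sv M' -> prodsv k M = prodsv k M'.
Proof. by move=> E; apply: eq_bigr => j _; apply: E. Qed.

Lemma prodsv_bound k n (M : 'M[C]_n) : gdet_bound k M (prodsv k M).
Proof.
have [V hV E] := sv_udiag M.
by apply: gdet_bound_udiag hV E => //; [apply: sv_dec|apply: sv_ge0].
Qed.

Definition std_frame n k : 'M[C]_(n, k) := \matrix_(i, j) (i == j :> nat)%:R.

Lemma rdiag_frame n k (d : nat -> R) : (k <= n)%N ->
  rdiag (fun j : 'I_n => d j) *m std_frame n k =
  std_frame n k *m rdiag (fun j : 'I_k => d j).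
Proof.
move=> kn; apply/matrixP => i j; rewrite /rdiag mul_diag_mx mul_mx_diag !mxE.
by case: eqVneq => [->|_]; rewrite ?mulr0 ?mul0r// mulrC.
Qed.

Lemma std_frameK n k : (k <= n)%N ->
  (std_frame n k) ^t* *m std_frame n k = 1%:M.
Proof.
move=> kn; apply/matrixP => i j; rewrite !mxE.
rewrite (bigD1 (widen_ord kn i))//= big1 => [|l li].
  by rewrite !mxE eqxx addr0 rmorph1 mul1r.
by rewrite !mxE [in X in X * _](negPf (_ : l != i :> nat)) ?rmorph0 ?mul0r.
Qed.

Lemma det_rdiag k (d : 'I_k -> R) : \det (rdiag d) = (\prod_j d j)%:C.
Proof.
by rewrite det_diag rmorph_prod; apply: eq_bigr => j _; rewrite mxE.
Qed.

Lemma gdet_udiag_frame n k (M V : 'M[C]_n) (d : nat -> R) : (k <= n)%N ->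
  V \is unitarymx -> M ^t* *m M = V ^t* *m rdiag d *m V ->
  gdet (M *m (V ^t* *m std_frame n k)) = (\prod_(j < k) d j)%:C.
Proof.
move=> kn hV E; rewrite /gdet !adjM trmxCK !mulmxA.
rewrite -[_ *m M ^t* *m M]mulmxA E !mulmxA.
rewrite -[_ *m V *m V ^t*]mulmxA (unitarymxP hV) mulmx1.
rewrite -[_ *m V *m V ^t*]mulmxA (unitarymxP hV) mulmx1.
by rewrite -mulmxA (rdiag_frame _ kn) mulmxA std_frameK// mul1mx det_rdiag.
Qed.

Lemma gdet_uframe n k (V : 'M[C]_n) : (k <= n)%N -> V \is unitarymx ->
  gdet (V ^t* *m std_frame n k) = 1.
Proof.
move=> kn hV; rewrite gdet_unitary ?adj_unitary// /gdet std_frameK//.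
exact: det1.
Qed.

(** The leading eigenvectors of [M^*] [M] form a frame that attains the
    bound. *)
Lemma prodsv_least k n (M : 'M[C]_n) c : (k <= n)%N -> 0 <= c ->
  gdet_bound k M c -> prodsv k M <= c.
Proof.
move=> kn c0 b; have [V hV E] := sv_udiag M.
have := b (V ^t* *m std_frame n k).
rewrite (gdet_udiag_frame (d := fun j => sv M j ^+ 2) kn hV E).
rewrite gdet_uframe// mulr1 lecR prodrXl.
by rewrite ler_pXn2r// nnegrE prodsv_ge0.
Qed.

Lemma prodsvM k n (M M' : 'M[C]_n) : (k <= n)%N ->
  prodsv k (M *m M') <= prodsv k M * prodsv k M'.
Proof.
move=> kn; apply: prodsv_least => // [|u]; first by rewrite mulr_ge0 ?prodsv_ge0.
rewrite -mulmxA; apply: le_trans (prodsv_bound M _) _.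
rewrite exprMn [X in _ <= X * _]rmorphM -[leRHS]mulrA; apply: ler_wpM2l; last exact: prodsv_bound.
by rewrite ler0c sqr_ge0.
Qed.

(** Any diagonalization with decreasing entries yields the same least
    bounds on frames, hence the same partial products. *)
Lemma sv_unique n (M V : 'M[C]_n) (d : nat -> R) :
  decreasing_seq d -> (forall j, 0 <= d j) -> V \is unitarymx ->
  M ^t* *m M = V ^t* *m rdiag (fun j => d j ^+ 2) *m V ->
  forall j, (j < n)%N -> sv M j = d j.
Proof.
move=> dd d0 hV E; apply: eq_of_prod_eq => //;
  [exact: sv_dec|exact: sv_ge0|move=> k kn].
apply/eqP; rewrite eq_le; apply/andP; split.
  apply: prodsv_least => //; first by apply: prodr_ge0.
  exact: gdet_bound_udiag hV E.
have := prodsv_bound (k := k) M (V ^t* *m std_frame n k).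
rewrite (gdet_udiag_frame (d := fun j => d j ^+ 2) kn hV E) gdet_uframe//.
rewrite mulr1 lecR prodrXl ler_pXn2r// nnegrE ?prodsv_ge0//.
by apply: prodr_ge0.
Qed.

Lemma udiag_gram n (V : 'M[C]_n) (d : 'I_n -> R) : V \is unitarymx ->
  (V ^t* *m rdiag d *m V) ^t* *m (V ^t* *m rdiag d *m V) =
  V ^t* *m rdiag (fun j => d j ^+ 2) *m V.
Proof.
move=> hV; rewrite udiag_herm !mulmxA.
rewrite -[_ *m V *m V ^t*]mulmxA (unitarymxP hV) mulmx1.
rewrite -[_ *m rdiag d *m rdiag d]mulmxA rdiagM.
by congr (_ *m _ *m _); apply: eq_rdiag => j; rewrite expr2.
Qed.

Lemma sv_of_udiag n (V : 'M[C]_n) (d : nat -> R) :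
  decreasing_seq d -> (forall j, 0 <= d j) -> V \is unitarymx ->
  forall j, (j < n)%N -> sv (V ^t* *m rdiag (fun j => d j) *m V) j = d j.
Proof.
by move=> dd d0 hV; apply: (sv_unique dd d0 hV (udiag_gram _ hV)).
Qed.

Lemma psd_udiag n (H : 'M[C]_n) : psd H ->
  exists2 V : 'M[C]_n, V \is unitarymx & H = V ^t* *m rdiag (fun j => sv H j) *m V.
Proof.
move=> pH; have [dd d0 [V hV E]] := sorted_evals_psd pH.
exists V; first exact: hV.
have -> : rdiag (fun j : 'I_n => sv H j) = rdiag (fun j : 'I_n => sorted_evals H j).
  apply: eq_rdiag => j; rewrite -(sv_of_udiag dd d0 hV (ltn_ord j)).
  by congr (sv _ j).
exact: E.
Qed.

Lemma sv_powmx n (H : 'M[C]_n) t j : psd H -> 0 <= t -> (j < n)%N ->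
  sv (powmx H t) j = sv H j `^ t.
Proof.
move=> pH t0; have [V hV E] := psd_udiag pH.
rewrite {1}E powmx.unlock /mxpowR (mxcalc_udiag _ _ hV); move: j.
apply: (@sv_of_udiag _ V (fun j => sv H j `^ t)) hV => [i j ij|j].
  by apply: ge0_ler_powR; rewrite ?nnegrE ?sv_ge0// sv_dec.
exact: powR_ge0.
Qed.

Lemma prodsv_powmx k n (H : 'M[C]_n) t : psd H -> 0 <= t -> (k <= n)%N ->
  prodsv k (powmx H t) = prodsv k H `^ t.
Proof.
move=> pH t0 kn; rewrite -prod_powR; last by move=> j; apply: sv_ge0.
by apply: eq_bigr => j _; rewrite sv_powmx// (leq_trans _ kn).
Qed.

Lemma sv_gram n (M : 'M[C]_n) j : sv (M ^t* *m M) j = sv M j ^+ 2.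
Proof.
have [jn|nj] := ltnP j n; last by rewrite !sv_out// expr0n.
have [V hV ->] := sv_udiag M; move: j jn.
apply: (@sv_of_udiag _ V (fun j => sv M j ^+ 2)) hV => [i j ij|j].
  by apply: lerXn2r; rewrite ?nnegrE ?sv_ge0// sv_dec.
exact: sqr_ge0.
Qed.

Lemma prodsv_gram k n (M : 'M[C]_n) : prodsv k (M ^t* *m M) = prodsv k M ^+ 2.
Proof. by rewrite -prodrXl; apply: eq_bigr => j _; rewrite sv_gram. Qed.

(** An eigenframe spans an invariant subspace; [c] is the determinant of the
    restriction. *)
Definition eigframe k n (M : 'M[C]_n) (c : R) := exists (u : 'M[C]_(n, k)) (l : 'M[C]_k),
  [/\ M *m u = u *m l, gdet u != 0 & \det l = c%:C].

Lemma eigframe_psd k n (H : 'M[C]_n) : psd H -> (k <= n)%N ->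
  eigframe k H (prodsv k H).
Proof.
move=> pH kn; have [V hV E] := psd_udiag pH.
exists (V ^t* *m std_frame n k), (rdiag (fun j => sv H j)); split.
- rewrite {1}E !mulmxA -[_ *m V *m V ^t*]mulmxA (unitarymxP hV) mulmx1.
  by rewrite -mulmxA (rdiag_frame _ kn) mulmxA.
- by rewrite gdet_uframe// oner_eq0.
- exact: det_rdiag.
Qed.

Lemma eigframe_rot k n (X Y : 'M[C]_n) c : c != 0 ->
  eigframe k (X *m Y) c -> eigframe k (Y *m X) c.
Proof.
move=> c0 [u [l [E u0 lc]]]; exists (Y *m u), l; split; last exact: lc.
  by rewrite -mulmxA [X *m _]mulmxA E mulmxA.
apply: contra_neq c0 => Yu0.
have := prodsv_bound X (Y *m u); rewrite Yu0 mulr0 mulmxA E (gdet_mulr _ lc).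
have up : 0 < gdet u by rewrite lt_def u0 gdet_ge0.
rewrite pmulr_lle0// => c2; apply/eqP; rewrite -sqrf_eq0 eq_le sqr_ge0 andbT.
by rewrite -lecR.
Qed.

Lemma eigframe_le k n (M : 'M[C]_n) c : 0 <= c -> eigframe k M c ->
  c <= prodsv k M.
Proof.
move=> c0 [u [l [E u0 lc]]]; have up : 0 < gdet u by rewrite lt_def u0 gdet_ge0.
have := prodsv_bound M u; rewrite E (gdet_mulr _ lc) ler_pM2r// lecR.
by rewrite ler_pXn2r// nnegrE prodsv_ge0.
Qed.

(** The replacement for the cyclicity of the spectral radius. *)
Lemma prodsv_cyclic k n (X Y : 'M[C]_n) : (k <= n)%N -> psd (X *m Y) ->
  prodsv k (X *m Y) <= prodsv k (Y *m X).
Proof.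
move=> kn pXY; have [->|c0] := eqVneq (prodsv k (X *m Y)) 0.
  exact: prodsv_ge0.
apply: eigframe_le; first exact: prodsv_ge0.
by apply: eigframe_rot c0 _; apply: eigframe_psd.
Qed.

Lemma sv_adj n (M : 'M[C]_n) j : sv (M ^t*) j = sv M j.
Proof.
have [jn|nj] := ltnP j n; last by rewrite !sv_out.
have le k (N : 'M[C]_n) : (k <= n)%N -> prodsv k N <= prodsv k (N ^t*).
  move=> kn; have := prodsv_cyclic kn (psd_gram N).
  have -> : N *m N ^t* = N ^t* ^t* *m N ^t* by rewrite trmxCK.
  by rewrite !prodsv_gram ler_pXn2r// nnegrE prodsv_ge0.
apply: eq_of_prod_eq jn; try exact: sv_dec; try exact: sv_ge0.
move=> k kn; apply/eqP; rewrite eq_le; apply/andP; split; last exact: le.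
by have := le k (M ^t*) kn; rewrite trmxCK.
Qed.

Lemma sv_mulU n (M U : 'M[C]_n) j : U \is unitarymx -> sv (M *m U) j = sv M j.
Proof.
move=> hU; rewrite -sv_adj -(sv_adj M); apply: sv_eq_gram.
by rewrite !trmxCK adjM mulmxA -[_ *m U *m _]mulmxA (unitarymxP hU) mulmx1.
Qed.

End SingularValueTheory.

(** * Products of powers and pinchings *)

Section PowersAndPinchings.
Variable R : realType.
Local Notation C := R[i].
Implicit Types (m n k : nat) (t : R).
Local Opaque determinant mxcalc prodsv sv.

Lemma powmx_double n (P : 'M[C]_n) t : psd P -> 0 <= t ->
  powmx P t *m powmx P t = powmx P (2 * t).
Proof. by move=> pP t0; rewrite (powmxD pP t0 t0) mulr_natl mulr2n. Qed.

Lemma gram_pow_mul n (P Q : 'M[C]_n) t : psd P -> 0 <= t ->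
  (powmx P t *m powmx Q t) ^t* *m (powmx P t *m powmx Q t) =
  powmx Q t *m (powmx P (2 * t) *m powmx Q t).
Proof.
move=> pP t0; rewrite adjM !powmx_herm !mulmxA -[_ *m powmx P t *m powmx P t]mulmxA.
by rewrite (powmx_double pP t0).
Qed.

Lemma prodsv_halve_low k n (P Q : 'M[C]_n) t : psd P -> psd Q -> (k <= n)%N ->
  0 <= t ->
  prodsv k (powmx P t *m powmx Q t) ^+ 2 <=
  prodsv k (powmx P (2 * t) *m powmx Q (2 * t)).
Proof.
move=> pP pQ kn t0; rewrite -prodsv_gram (gram_pow_mul _ pP t0).
apply: le_trans (prodsv_cyclic kn _) _.
  by rewrite -(gram_pow_mul _ pP t0); apply: psd_gram.
by rewrite -mulmxA (powmx_double pQ t0).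
Qed.

Lemma prodsv_halve_high k n (P Q : 'M[C]_n) t : psd P -> psd Q -> (k <= n)%N ->
  1 <= 2 * t ->
  prodsv k (powmx P t *m powmx Q t) ^+ 2 <=
  prodsv k (powmx P (2 * t - 1) *m powmx Q (2 * t - 1)) * prodsv k (P *m Q).
Proof.
move=> pP pQ kn t1; have t0 : 0 <= t by lra.
have s0 : 0 <= 2 * t - 1 by lra.
have [->|c0] := eqVneq (prodsv k (powmx P t *m powmx Q t)) 0.
  by rewrite expr0n mulr_ge0 ?prodsv_ge0.
have c20 : prodsv k (powmx P t *m powmx Q t) ^+ 2 != 0 by rewrite sqrf_eq0.
have := eigframe_psd (psd_gram (powmx P t *m powmx Q t)) kn.
rewrite prodsv_gram (gram_pow_mul _ pP t0) => /(eigframe_rot c20).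
rewrite -mulmxA (powmx_double pQ t0).
have t1E : 1 + (2 * t - 1) = 2 * t by lra.
have t1E' : 2 * t - 1 + 1 = 2 * t by lra.
have E : powmx P (2 * t) *m powmx Q (2 * t) =
    powmx P (2 * t - 1) *m (P *m Q *m powmx Q (2 * t - 1)).
  rewrite -[P *m Q *m _]mulmxA -[X in P *m (X *m _)](powmx1 pQ).
  rewrite (powmxD pQ ler01 s0) t1E mulmxA -[X in _ *m X *m _](powmx1 pP).
  by rewrite (powmxD pP s0 ler01) t1E'.
rewrite E => /(eigframe_rot c20) /eigframe_le; rewrite sqr_ge0 => /(_ isT).
move=> /le_trans; apply; rewrite -mulmxA [leRHS]mulrC.
apply: le_trans (prodsvM _ _ kn) _; apply: ler_wpM2l; first exact: prodsv_ge0.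
rewrite le_eqVlt; apply/orP; left; apply/eqP.
rewrite -(eq_prodsv k (sv_adj (powmx P _ *m _))).
by rewrite adjM (powmx_herm P) (powmx_herm Q).
Qed.

Lemma powR_le1D (x t : R) : 0 <= x -> 0 <= t <= 1 -> x `^ t <= 1 + x.
Proof.
move=> x0 /andP[t0 t1]; have [x1|x1] := leP 1 x.
  by apply: le_trans (ler_powR x1 t1) _; rewrite powRr1// lerDr.
have : x `^ t <= 1 `^ t by apply: ge0_ler_powR; rewrite ?nnegrE// ltW.
by rewrite powR1 => /le_trans; apply; rewrite lerDl.
Qed.

(** The Araki-Cordes inequality. Both halving inequalities come from the
    cyclicity of eigenframes, so the self-improvement of a bounded function
    gives all real exponents at once. *)
Lemma araki_cordes k n (P Q : 'M[C]_n) t : psd P -> psd Q -> (k <= n)%N ->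
  0 <= t <= 1 ->
  prodsv k (powmx P t *m powmx Q t) <= prodsv k (P *m Q) `^ t.
Proof.
move=> pP pQ kn t01; set m0 := prodsv k (P *m Q).
have m00 : 0 <= m0 by exact: prodsv_ge0.
(* A positive upper bound [m] replaces [m0], which may vanish. *)
have key (m : R) : 0 < m -> m0 <= m ->
    prodsv k (powmx P t *m powmx Q t) <= m `^ t.
  move=> mp m0m; pose g u := prodsv k (powmx P u *m powmx Q u) * m^-1 `^ u.
  have ivp : 0 < m^-1 by rewrite invr_gt0.
  have inv0 := ltW ivp.
  have gsq u : (m^-1 `^ u) ^+ 2 = m^-1 `^ (2 * u).
    by rewrite -powR_mulrn ?powR_ge0// -powRrM mulrC.
  suff : g t <= 1.
    by rewrite /g -[_^-1]powR_inv1 ?(ltW mp)// -powRrM mulN1r powRN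
      ler_pdivrMr ?powR_gt0// mul1r.
  apply: (@halving_le1 _ g ((1 + prodsv k P) * (1 + prodsv k Q) * (1 + m^-1)))
    => // [u u01|u u0 u1|u u1 u2].
  - have u0 : 0 <= u by case/andP: u01.
    rewrite /g mulr_ge0 ?prodsv_ge0 ?powR_ge0//=.
    apply: ler_pM; rewrite ?prodsv_ge0 ?powR_ge0//; last exact: powR_le1D.
    apply: le_trans (prodsvM _ _ kn) _; rewrite !prodsv_powmx//.
    by apply: ler_pM; rewrite ?powR_ge0// powR_le1D ?prodsv_ge0.
  - rewrite /g exprMn gsq; apply: ler_wpM2r; first exact: powR_ge0.
    exact: (prodsv_halve_low pP pQ kn u0).
  - rewrite /g exprMn gsq.
    have -> : m^-1 `^ (2 * u) = m^-1 `^ (2 * u - 1) * m^-1.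
      rewrite -[X in _ = _ * X]powRr1// -powRD; last by apply/implyP => _; rewrite gt_eqF.
      by congr (_ `^ _); lra.
    have h := prodsv_halve_high pP pQ kn u2; rewrite -/m0 in h.
    apply: le_trans (ler_wpM2r _ h) _; first by rewrite mulr_ge0 ?powR_ge0.
    rewrite -mulrA; apply: ler_wpM2l; first exact: prodsv_ge0.
    rewrite mulrCA -[leRHS]mulr1; apply: ler_wpM2l; first exact: powR_ge0.
    by rewrite ler_pdivrMr// mul1r.
clearbody m0; have /orP[m0p|m0n] : (0 < m0) || (m0 <= 0) by case: (ltP 0 m0).
  exact: (key m0 m0p (lexx _)).
have m0E : m0 = 0 by apply/eqP; rewrite eq_le m0n.
have [->|tn0] := eqVneq t 0.
  have -> : powmx P 0 *m powmx Q 0 = powmx P 0 *m powmx P 0.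
    by rewrite !powmx0.
  rewrite (powmxD pP (lexx 0) (lexx 0)) addr0 (prodsv_powmx pP (lexx 0) kn).
  by rewrite !powRr0.
have tp : 0 < t by rewrite lt_def tn0; case/andP: t01.
rewrite m0E (powR0 tn0); rewrite {}m0E in key.
move: (prodsv k _) key => c key; rewrite leNgt; apply/negP => cp.
have c2 : 0 < c / 2 by rewrite divr_gt0.
have := key _ (powR_gt0 t^-1 c2) (powR_ge0 _ _).
by rewrite -powRrM mulVf// powRr1 ?(ltW c2)//; lra.
Qed.

(** ** Ky Fan sums of a pinching *)

Lemma mxtrace_udiag_unitary n (V : 'M[C]_n) d : V \is unitarymx ->
  \tr (V ^t* *m rdiag d *m V) = (\sum_j d j)%:C.
Proof.
move=> hV; rewrite mxtrace_mulC mulmxA (unitarymxP hV) mul1mx mxtrace_diag.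
by rewrite rmorph_sum; apply: eq_bigr => j _; rewrite mxE.
Qed.

Lemma mxtrace_pinch n (X M p : 'M[C]_n) :
  \tr (X *m (p *m M *m p)) = \tr (p *m X *m p *m M).
Proof. by rewrite !mulmxA [LHS]mxtrace_mulC !mulmxA. Qed.

Lemma congr_udiag_ge0 n (V X : 'M[C]_n) d j : (forall i, 0 <= d i) ->
  0 <= (X ^t* *m (V ^t* *m rdiag d *m V) *m X) j j.
Proof.
move=> d0; have -> : rdiag d = (rdiag (Num.sqrt \o d)) ^t* *m
    rdiag (Num.sqrt \o d).
  by rewrite rdiag_adj rdiagM; apply: eq_rdiag => i /=; rewrite -expr2 sqr_sqrtr.
set D := rdiag _.
have -> : X ^t* *m (V ^t* *m (D ^t* *m D) *m V) *m X =
   (D *m V *m X) ^t* *m (D *m V *m X) by rewrite !adjM !mulmxA.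
exact: gram_ge0.
Qed.

(** Pair [G] with the projection onto its leading eigenvectors: moving the
    pinching from [M] to this projection keeps the trace and the bounds by 0
    and 1, hence only loses against the leading eigenvalues of [M]. *)
Lemma sum_sv_pinching (I : finType) k n (p : I -> 'M[C]_n) (G M : 'M[C]_n) :
  (k <= n)%N -> psd G -> psd M ->
  (forall i, (p i) ^t* = p i) -> (forall i, p i *m p i = p i) ->
  \sum_i p i = 1%:M -> G = \sum_i p i *m M *m p i ->
  \sum_(j < k) sv G j <= \sum_(j < k) sv M j.
Proof.
move=> kn pG pM ph pp p1 GE.
have [V hV EG] := psd_udiag pG; have [U hU EM] := psd_udiag pM.
(* [Pr ind] projects onto the first [k] eigenvectors of [G], and [T ind] is
   the pinching of this projection, written in the eigenbasis of [M]. *)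
pose ind (j : 'I_n) : R := (j < k)%:R.
pose Pr e := V ^t* *m rdiag e *m V.
pose pinch X := \sum_i p i *m X *m p i.
pose T e : 'M[C]_n := U *m pinch (Pr e) *m U ^t*.
have TE e : T e = \sum_i (p i *m U ^t*) ^t* *m Pr e *m (p i *m U ^t*).
  rewrite /T /pinch mulmx_sumr mulmx_suml; apply: eq_bigr => i _.
  by rewrite adjM trmxCK ph !mulmxA.
have Tge0 e j : (forall i, 0 <= e i) -> 0 <= T e j j.
  move=> e0; rewrite TE summxE; apply: sumr_ge0 => i _.
  exact: congr_udiag_ge0.
have TD : T ind + T (fun j => 1 - ind j) = 1%:M.
  rewrite /T -mulmxDl -mulmxDr /pinch -big_split /=.
  have -> : \sum_i (p i *m Pr ind *m p i + p i *m Pr (fun j => 1 - ind j) *m p i)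
     = \sum_i p i.
    apply: eq_bigr => i _; rewrite -mulmxDl -mulmxDr /Pr -mulmxDl -mulmxDr.
    have -> : rdiag ind + rdiag (fun j => 1 - ind j) = 1%:M.
      rewrite -rdiag1; apply/matrixP => a b; rewrite mxE !rdiagE -mulrnDl.
      by rewrite -rmorphD addrCA subrr addr0.
    by rewrite mulmx1 (unitary_mulVmx hV) mulmx1 pp.
  by rewrite p1 mulmx1 (unitarymxP hU).
have ind0 j : 0 <= ind j by exact: ler0n.
have ind1 j : 0 <= 1 - ind j by rewrite subr_ge0 lern1 leq_b1.
pose c (j : nat) : R := if insub j is Some i then complex.Re (T ind i i) else 0.
have cE (j : 'I_n) : (c j)%:C = T ind j j.
  by rewrite /c valK RRe_real// ger0_real// Tge0.
have trT : \tr (T ind) = k%:R.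
  rewrite /T mxtrace_mulC mulmxA (unitary_mulVmx hU) mul1mx /pinch raddf_sum /=.
  have -> : \sum_i \tr (p i *m Pr ind *m p i) = \tr (Pr ind).
    rewrite -[in RHS](mul1mx (Pr ind)) -p1 mulmx_suml raddf_sum.
    by apply: eq_bigr => i _; rewrite mxtrace_mulC mulmxA pp.
  rewrite mxtrace_udiag_unitary// -(rmorph_nat (real_complex R)); congr (_%:C).
  rewrite /ind -natr_sum; congr (_%:R).
  rewrite -[k in RHS]card_ord -sum1_card (big_ord_widen n (fun=> 1%N) kn).
  by rewrite [RHS]big_mkcond; apply: eq_bigr => j _; case: (j < k)%N.
have trG : \tr (Pr ind *m G) = (\sum_(j < k) sv G j)%:C.
  rewrite {1}EG /Pr !mulmxA -[_ *m V *m V ^t*]mulmxA (unitarymxP hV) mulmx1.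
  rewrite -[_ *m rdiag _ *m rdiag _]mulmxA rdiagM mxtrace_udiag_unitary//.
  congr (_%:C); rewrite (big_ord_widen n (sv G) kn) [RHS]big_mkcond.
  by apply: eq_bigr => j _; rewrite /ind; case: ifP; rewrite ?mul1r ?mul0r.
have trM : \tr (Pr ind *m G) = (\sum_(j < n) sv M j * c j)%:C.
  rewrite [in LHS]GE mulmx_sumr raddf_sum /=.
  have -> : \sum_i \tr (Pr ind *m (p i *m M *m p i)) = \tr (pinch (Pr ind) *m M).
    rewrite /pinch mulmx_suml raddf_sum; apply: eq_bigr => i _ /=.
    by rewrite mxtrace_pinch.
  rewrite [in LHS]EM !mulmxA mxtrace_mulC !mulmxA.
  rewrite /mxtrace rmorph_sum; apply: eq_bigr => j _.
  by rewrite mul_mx_diag mxE rmorphM /= cE mxE mulrC.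
rewrite -lecR -trG trM lecR; apply: (bathtub (n := n)).
- exact: sv_dec.
- exact: sv_ge0.
- move=> j jn; have := cE (Ordinal jn) => /= cj.
  rewrite -ler0c -[c j <= 1]lecR cj Tge0//=.
  have /matrixP/(_ (Ordinal jn) (Ordinal jn)) := TD.
  rewrite mxE [RHS]mxE eqxx => E1.
  have h := Tge0 _ (Ordinal jn) ind1.
  by rewrite -[leRHS](E1 : _ = 1) lerDl.
- apply: complexI; rewrite rmorph_sum rmorph_nat -trT.
  by apply: eq_bigr => j _; exact: cE.
Qed.

End PowersAndPinchings.

(** * Unitarily invariant norms and Ky Fan dominance *)

Section KyFanDominance.
Variables (R : realType) (n : nat) (N : 'M[R[i]]_n -> R).
Hypothesis hN : unitarily_invariant_norm N.
Local Notation C := R[i].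
Local Opaque determinant mxcalc prodsv sv.

Let gauge (d : nat -> R) : R := N (rdiag (fun j : 'I_n => d j)).

Lemma eq_gauge (d e : nat -> R) : (forall j : 'I_n, d j = e j) -> gauge d = gauge e.
Proof. by move=> de; rewrite /gauge (eq_rdiag de). Qed.

Lemma gauge_sv (H : 'M[C]_n) : psd H -> N H = gauge (sv H).
Proof.
move=> pH; have [V hV E] := psd_udiag pH.
by rewrite {1}E (uinormU hN) ?adj_unitary.
Qed.

Lemma gauge_convex (d e : nat -> R) (a : R) : 0 <= a <= 1 -> gauge d = gauge e ->
  gauge (fun j => a * d j + (1 - a) * e j) <= gauge d.
Proof.
move=> /andP[a0 a1] de.
have -> : gauge (fun j => a * d j + (1 - a) * e j) =
    N (a%:C *: rdiag (fun j : 'I_n => d j) +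
       (1 - a)%:C *: rdiag (fun j : 'I_n => e j)).
  congr N; apply/matrixP => i j; rewrite !mxE.
  case: eqVneq => [->|_]; rewrite ?mulr0n ?mulr0 ?addr0//.
  by rewrite !mulr1n rmorphD !rmorphM.
apply: le_trans (uinormD hN _ _) _; rewrite !(uinormZ hN).
have Re_norm (x : R) : 0 <= x -> complex.Re `|x%:C| = x.
  by move=> x0; rewrite ger0_norm// ler0c.
rewrite !Re_norm ?subr_ge0// -/(gauge d) -/(gauge e) -de.
by rewrite le_eqVlt; apply/orP; left; apply/eqP; ring.
Qed.

Lemma gauge_swap (y : nat -> R) (i j : 'I_n) :
  gauge (fun l => if l == i :> nat then y j else if l == j :> nat then y i else y l)
  = gauge y.
Proof.
set P : 'M[C]_n := perm_mx (tperm i j).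
have PP : P *m P ^t* = 1%:M.
  by rewrite /P tr_perm_mx map_perm_mx -perm_mxM mulgV perm_mx1.
have hP : P \is unitarymx by apply/unitarymxP.
rewrite /gauge -[RHS](uinormU hN _ hP (adj_unitary hP)); congr N.
apply/matrixP => a b; rewrite /P tr_perm_mx map_perm_mx -row_permE -col_permE.
rewrite rdiagE !mxE (inj_eq perm_inj) ?tpermV; congr (_%:C *+ _).
case: tpermP => [->|->|/eqP ai /eqP aj].
- by rewrite eqxx.
- by case: eqVneq => [->//|_]; rewrite eqxx.
- by rewrite !val_eqE (negPf ai) (negPf aj).
Qed.

Lemma gauge_flip (y : nat -> R) (i : 'I_n) :
  gauge (fun l => if l == i :> nat then - y l else y l) = gauge y.
Proof.
pose s (l : 'I_n) : R := if l == i then -1 else 1.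
have ss : rdiag s *m (rdiag s) ^t* = 1%:M.
  rewrite rdiag_adj rdiagM -rdiag1; apply: eq_rdiag => l.
  by rewrite /s; case: ifP; rewrite ?mulrNN mulr1.
have hs : rdiag s \is unitarymx by apply/unitarymxP.
have h1 : (1%:M : 'M[C]_n) \is unitarymx.
  by apply/unitarymxP; rewrite adj1 mulmx1.
rewrite /gauge -[RHS](uinormU hN _ hs h1); congr N.
rewrite mulmx1 rdiagM; apply: eq_rdiag => l.
by rewrite /s val_eqE; case: ifP; rewrite ?mulN1r ?mul1r.
Qed.

(** Robin Hood transfer: the new vector is a convex combination of [y] and of
    its transposition. *)
Lemma gauge_transfer (y : nat -> R) (i j : 'I_n) (c : R) : i != j ->
  0 <= c <= y i - y j ->
  gauge (fun l => if l == i :> nat then y i - c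
    else if l == j :> nat then y j + c else y l) <= gauge y.
Proof.
move=> ij /andP[c0 cy].
have [yij|yij] := eqVneq (y i) (y j).
  have c00 : c = 0 by apply/eqP; rewrite eq_le c0 andbT; move: cy; rewrite yij subrr.
  rewrite le_eqVlt; apply/orP; left; apply/eqP; apply: eq_gauge => l.
  by rewrite c00 subr0 addr0; case: eqP => [->//|_]; case: eqP => [->|].
have yp : 0 < y i - y j by rewrite lt_def subr_eq0 yij; apply: le_trans cy.
pose a := 1 - c / (y i - y j).
have a01 : 0 <= a <= 1.
  by rewrite subr_ge0 ler_pdivrMr// mul1r cy gerBl divr_ge0// ltW.
have ca : c = (1 - a) * (y i - y j).
  by rewrite /a opprB addrCA subrr addr0 divfK// gt_eqF.
apply: le_trans (gauge_convex a01 (esym (gauge_swap y i j))).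
rewrite le_eqVlt; apply/orP; left; apply/eqP; apply: eq_gauge => l.
rewrite ca /= !val_eqE; case: eqVneq => [->|_]; first by ring.
by case: eqVneq => [->|_]; ring.
Qed.

Lemma gauge_shrink (y : nat -> R) (i : 'I_n) (c : R) : 0 <= c <= y i ->
  gauge (fun l => if l == i :> nat then c else y l) <= gauge y.
Proof.
move=> /andP[c0 cy]; have [y0|y0] := eqVneq (y i) 0.
  have c00 : c = 0 by apply/eqP; rewrite eq_le c0 andbT -y0.
  rewrite le_eqVlt; apply/orP; left; apply/eqP; apply: eq_gauge => l.
  by case: eqP => [->|//]; rewrite y0.
have yp : 0 < y i by rewrite lt_def y0; apply: le_trans cy.
pose a := (1 + c / y i) / 2.
have q0 : 0 <= c / y i by rewrite divr_ge0// ltW.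
have q1 : c / y i <= 1 by rewrite ler_pdivrMr// mul1r.
have a01 : 0 <= a <= 1 by rewrite /a; lra.
have ca : c = (a - (1 - a)) * y i.
  have -> : a - (1 - a) = c / y i by rewrite /a; lra.
  by rewrite divfK.
apply: le_trans (gauge_convex a01 (esym (gauge_flip y i))).
rewrite le_eqVlt; apply/orP; left; apply/eqP; apply: eq_gauge => l.
rewrite [in LHS]ca /= !val_eqE; case: eqVneq => [->|_]; by ring.
Qed.

(** Transfers from a surplus to a later deficit keep the partial sums above
    those of [x] and equalize an entry each time. *)
Lemma gauge_le (x y : nat -> R) : decreasing_seq x -> (forall j, 0 <= x j) ->
  (forall j, 0 <= y j) ->
  (forall k, (k <= n)%N -> \sum_(j < k) x j <= \sum_(j < k) y j) ->
  gauge x <= gauge y.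
Proof.
move=> xd x0; have [q] := ubnP #|[set l : 'I_n | x l != y l]|.
elim: q y => // q IH y; rewrite ltnS => cq y0 xy.
have dec (z : nat -> R) (i : 'I_n) : (forall l : 'I_n, x l = y l -> z l = y l) ->
    x i != y i -> z i = x i -> (#|[set l : 'I_n | x l != z l]| < q)%N.
  move=> zy xyi zi; apply: leq_trans cq; apply: proper_card; apply/properP; split.
    by apply/subsetP => l; rewrite !inE; apply: contra => /eqP e; rewrite (zy _ e) e.
  by exists i; rewrite !inE ?zi ?eqxx.
have [[j0 xyj0]|noj] := pselect (exists j : 'I_n, y j < x j); last first.
  have xle (j : 'I_n) : x j <= y j.
    by rewrite leNgt; apply/negP => h; apply: noj; exists j.
  have [[i xyi]|eqxy] := pselect (exists i : 'I_n, x i != y i); last first.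
    rewrite (@eq_gauge x y)// => j; apply/eqP/negPn/negP => h.
    by apply: eqxy; exists j.
  pose z l := if l == i :> nat then x i else y l.
  apply: le_trans (gauge_shrink (y := y) (i := i) (c := x i) _); last first.
    by rewrite x0 xle.
  apply: IH => [|j|k kn].
  - apply: (dec z i _ xyi) => [l xl|]; rewrite /z ?eqxx//.
    by case: eqP => // /val_inj <-.
  - by case: ifP.
  - apply: ler_sum => j _; have jn := leq_trans (ltn_ord j) kn.
    by case: eqP => [->//|_]; exact: (xle (Ordinal jn)).
(* The first deficit [j]: before it, [y] dominates [x] entrywise. *)
have [j xyj jmin] := @arg_minnP _ j0 (fun j : 'I_n => y j < x j) val xyj0.
have below l : (l < j)%N -> x l <= y l.
  move=> lj; rewrite leNgt; apply/negP => h.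
  have := jmin (Ordinal (ltn_trans lj (ltn_ord j))) h.
  by rewrite /= leqNgt lj.
have [[i [ij xyi]]|noi] := pselect (exists i : 'I_n, (i < j)%N /\ x i < y i);
  last first.
  have := xy _ (ltn_ord j); rewrite !big_ord_recr /= => h; exfalso; move: h.
  apply/negP; rewrite -ltNge; apply: ler_ltD xyj; apply: ler_sum => l _.
  rewrite leNgt; apply/negP => h; apply: noi.
  exists (Ordinal (ltn_trans (ltn_ord l) (ltn_ord j))).
  by split; [exact: (ltn_ord l)|exact: h].
pose c := Num.min (y i - x i) (x j - y j).
have c0 : 0 < c by rewrite lt_min !subr_gt0 xyi.
have ci : c <= y i - x i by rewrite ge_min lexx.
have cj : c <= x j - y j by rewrite ge_min lexx orbT.
have ij' : i != j by rewrite -val_eqE ltn_eqF.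
have xij : x j <= x i by apply: xd; apply: ltnW.
have cy : 0 <= c <= y i - y j by rewrite (ltW c0)/=; lra.
apply: le_trans (gauge_transfer ij' cy).
pose z l := if l == i :> nat then y i - c else if l == j :> nat then y j + c else y l.
have zi : z i = y i - c by rewrite /z eqxx.
have zj : z j = y j + c by rewrite /z val_eqE eq_sym (negPf ij') eqxx.
apply: (IH z) => [|l|k kn].
- have zl (l : 'I_n) : x l = y l -> z l = y l.
    move=> xl; rewrite /z; case: eqP => [/val_inj li|_].
      by move: xyi; rewrite -li xl ltxx.
    by case: eqP => // /val_inj lj; move: xyj; rewrite -lj xl ltxx.
  have [cE|cE] := leP (y i - x i) (x j - y j).
    have cE' : c = y i - x i by rewrite /c min_l.
    by apply: (dec z i zl); rewrite ?zi ?cE' ?lt_eqF//; lra.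
  have cE' : c = x j - y j by rewrite /c min_r// ltW.
  by apply: (dec z j zl); rewrite ?zj ?cE' ?gt_eqF//; lra.
- rewrite /z; case: eqP => _; first by have := x0 i; lra.
  by case: eqP => _ //; rewrite addr_ge0// ltW.
have zE l : z l = y l + (if l == j :> nat then c else 0) - (if l == i :> nat then c else 0).
  rewrite /z; case: eqP => [->|_]; last by case: eqP => [->|_]; lra.
  by rewrite val_eqE (negPf ij'); lra.
have single (e : 'I_n) : \sum_(l < k) (if l == e :> nat then c else 0) =
    if (e < k)%N then c else 0.
  rewrite -big_mkcond /=; case: ifP => ek.
    by rewrite (big_pred1 (Ordinal ek)).
  by rewrite big_pred0// => l; apply/negbTE; apply: contraFneq ek => <-.
rewrite (eq_bigr _ (fun l _ => zE (val l))) sumrB big_split /= !single.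
have := xy k kn; case: (ltnP j k) => jk.
  by rewrite (ltn_trans ij jk); lra.
rewrite addr0; case: ifP => ik; last by rewrite subr0.
move=> _; rewrite (bigD1 (Ordinal ik))//= [in leRHS](bigD1 (Ordinal ik))//=.
have : \sum_(l < k | l != Ordinal ik) x l <= \sum_(l < k | l != Ordinal ik) y l.
  by apply: ler_sum => l _; apply: below; apply: leq_trans jk.
lra.
Qed.

(** Ky Fan's dominance principle. *)
Lemma uinorm_dominance (H H' : 'M[C]_n) : psd H -> psd H' ->
  (forall k, (k <= n)%N -> \sum_(j < k) sv H j <= \sum_(j < k) sv H' j) ->
  N H <= N H'.
Proof.
move=> pH pH' sums; rewrite !gauge_sv//.
by apply: gauge_le sums; [exact: sv_dec|exact: sv_ge0|exact: sv_ge0].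
Qed.

End KyFanDominance.

(** * Geometric means *)

Section GeometricMean.
Variable R : realType.
Local Notation C := R[i].
Implicit Types (m n k : nat) (t s r : R).
Local Opaque determinant mxcalc prodsv sv.

Lemma powmx_intertwine m n (G : 'M[C]_m) (H : 'M[C]_n) (X : 'M[C]_(m, n)) t :
  G ^t* = G -> H ^t* = H -> G *m X = X *m H ->
  powmx G t *m X = X *m powmx H t.
Proof.
by move=> hG hH GX; rewrite powmx.unlock; apply: mxcalc_intertwine.
Qed.

Lemma powmx_half n (H : 'M[C]_n) : psd H ->
  powmx H (1 / 2) *m powmx H (1 / 2) = H.
Proof.
move=> pH; have h0 : 0 <= 1 / 2 :> R by lra.
have e : 2 * (1 / 2) = 1 :> R by lra.
by rewrite (powmx_double pH h0) e powmx1.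
Qed.

Lemma powmx_conj_unitary n (H W : 'M[C]_n) t : H ^t* = H -> W \is unitarymx ->
  powmx (W *m H *m W ^t*) t *m W = W *m powmx H t.
Proof.
move=> hH hW; apply: powmx_intertwine => //.
  by rewrite !adjM trmxCK hH mulmxA.
by rewrite -[LHS]mulmxA (unitary_mulVmx hW) mulmx1.
Qed.

(** [geomean], written with sealed powers. *)
Definition gmean n (A B : 'M[C]_n) : 'M[C]_n :=
  powmx A (1 / 2)
    *m powmx (powmx A (- (1 / 2)) *m B *m powmx A (- (1 / 2))) (1 / 2)
    *m powmx A (1 / 2).

Lemma gmeanE n (A B : 'M[C]_n) : geomean A B = gmean A B.
Proof. by rewrite /geomean /gmean powmx.unlock. Qed.

Lemma gmean_pd n (A B : 'M[C]_n) : pd A -> pd B -> pd (gmean A B).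
Proof.
move=> pA pB; rewrite /gmean.
set S := powmx A (1 / 2); set T := powmx A (- (1 / 2)).
have uS : S \in unitmx by apply/pd_unit/powmx_pd.
have uT : T \in unitmx by apply/pd_unit/powmx_pd.
have hS : S ^t* = S by apply: powmx_herm.
have hT : T ^t* = T by apply: powmx_herm.
have pT : pd (T *m B *m T).
  have -> : T *m B *m T = (powmx B (1 / 2) *m T) ^t* *m (powmx B (1 / 2) *m T).
    rewrite adjM hT powmx_herm mulmxA -[_ *m powmx B _ *m powmx B _]mulmxA.
    by rewrite (powmx_half (pd_psd pB)).
  apply: pd_gram; rewrite unitmx_mul uT andbT.
  exact/pd_unit/powmx_pd.
set H := powmx (T *m B *m T) (1 / 2).
have pH : pd H by apply: powmx_pd.
have -> : S *m H *m S = (powmx H (1 / 2) *m S) ^t* *m (powmx H (1 / 2) *m S).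
  rewrite adjM hS powmx_herm mulmxA -[_ *m powmx H _ *m powmx H _]mulmxA.
  by rewrite (powmx_half (pd_psd pH)).
apply: pd_gram; rewrite unitmx_mul uS andbT.
exact/pd_unit/powmx_pd.
Qed.

(** The geometric mean is [A^(1/2) W B^(1/2)] with a unitary middle factor. *)
Lemma gmean_polar n (A B : 'M[C]_n) : pd A -> pd B ->
  exists2 W : 'M[C]_n, W \is unitarymx &
    gmean A B = powmx A (1 / 2) *m W *m powmx B (1 / 2).
Proof.
move=> pA pB; rewrite /gmean.
set S := powmx A (1 / 2); set T := powmx A (- (1 / 2)).
set U := powmx B (1 / 2); pose V := powmx B (- (1 / 2)).
have hS : S ^t* = S by apply: powmx_herm.
have hV : V ^t* = V by apply: powmx_herm.
have ST : S *m T = 1%:M by rewrite (powmxD_pd _ _ pA) subrr powmx0.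
have TS : T *m S = 1%:M by rewrite (powmxD_pd _ _ pA) addNr powmx0.
have UV : U *m V = 1%:M by rewrite (powmxD_pd _ _ pB) subrr powmx0.
have VU : V *m U = 1%:M by rewrite (powmxD_pd _ _ pB) addNr powmx0.
have UU : U *m U = B by rewrite (powmx_half (pd_psd pB)).
have pT : psd (T *m B *m T).
  rewrite -{1}[T](powmx_herm A (- (1 / 2))) -/T.
  by apply: psd_congr; apply: pd_psd.
set H := powmx (T *m B *m T) (1 / 2).
have hH : H ^t* = H by apply: powmx_herm.
have HH : H *m H = T *m B *m T by rewrite (powmx_half pT).
exists (H *m S *m V).
  have : (H *m S *m V) ^t* *m (H *m S *m V) = 1%:M.
    rewrite !adjM hH hS hV !mulmxA -[_ *m H *m H]mulmxA HH.
    rewrite !mulmxA -[_ *m S *m T]mulmxA ST mulmx1 -[_ *m T *m S]mulmxA TS mulmx1.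
    by rewrite -UU !mulmxA VU mul1mx UV.
  by move=> /mulmx1C e; apply/unitarymxP.
by rewrite !mulmxA -[_ *m V *m U]mulmxA VU mulmx1.
Qed.

(** The middle factor [A^(-1/2) (A^s # B^s) B^(-1/2)] equals
    [A^((s-1)/2) W B^((s-1)/2)], and Araki-Cordes compares it with
    [A^(s/2) W B^(s/2)]. *)
Lemma prodsv_gmean_factor k n (A B : 'M[C]_n) s : pd A -> pd B -> 1 <= s ->
  (k <= n)%N ->
  prodsv k (powmx A (- (1 / 2)) *m gmean (powmx A s) (powmx B s)
            *m powmx B (- (1 / 2)))
  <= prodsv k (gmean (powmx A s) (powmx B s)) `^ ((s - 1) / s).
Proof.
move=> pA pB s1 kn; have s0 : 0 < s by apply: lt_le_trans s1.
have [W hW E] := gmean_polar (powmx_pd s pA) (powmx_pd s pB).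
rewrite !powmxM in E.
set G := gmean _ _ in E *; set t := (s - 1) / s.
have t01 : 0 <= t <= 1.
  by rewrite /t divr_ge0 ?subr_ge0 ?(ltW s0)//= ler_pdivrMr// mul1r gerBl.
pose P := powmx A (s * (1 / 2)).
pose Q := W *m powmx B (s * (1 / 2)) *m W ^t*.
have pP : psd P by apply: powmx_psd.
have pQ : psd Q.
  rewrite /Q -[W in W *m powmx B _]trmxCK; apply: psd_congr.
  exact: powmx_psd.
have st : s * (1 / 2) * t = - (1 / 2) + s * (1 / 2).
  by rewrite /t; field; rewrite gt_eqF.
have st' : s * (1 / 2) * t = s * (1 / 2) + - (1 / 2) by rewrite st addrC.
have DE : powmx A (- (1 / 2)) *m G *m powmx B (- (1 / 2)) =
    powmx P t *m powmx Q t *m W.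
  rewrite -[RHS]mulmxA (powmx_conj_unitary _ (powmx_herm _ _) hW) !powmxM.
  rewrite {1}st st' -(powmxD_pd _ _ pA) -(powmxD_pd _ _ pB) E !mulmxA.
  by [].
have PQ : P *m Q = G *m W ^t* by rewrite E /P /Q !mulmxA.
rewrite DE (eq_prodsv k (fun j => sv_mulU (powmx P t *m powmx Q t) j hW)).
have := araki_cordes pP pQ kn t01; rewrite PQ.
by rewrite (eq_prodsv k (fun j => sv_mulU G j (adj_unitary hW))).
Qed.

Lemma absorb (s x y : R) : s * x <= (s - 1) * x + y -> x <= y.
Proof. by rewrite mulrBl mul1r; lra. Qed.

Lemma absorb_le (s x y : R) : 1 <= s -> x <= y -> (s - 1) * x + y <= s * y.
Proof.
move=> s1 xy; have : (s - 1) * x <= (s - 1) * y by rewrite ler_wpM2l// subr_ge0.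
by lra.
Qed.

Lemma young_prod (d c s r : R) : 0 <= d -> 0 <= c -> 1 < s ->
  s * (d * c) `^ r <= (s - 1) * d `^ (r * s / (s - 1)) + c `^ (s * r).
Proof.
move=> d0 c0 s1; have s10 : 0 < s - 1 by rewrite subr_gt0.
have := young_powR (powR_ge0 d (r / (s - 1))) (powR_ge0 c r) (ltW s1).
rewrite -!powRrM powRM//.
have -> : r / (s - 1) * (s - 1) = r by rewrite divfK ?gt_eqF.
have -> : r / (s - 1) * s = r * s / (s - 1) by rewrite mulrAC.
by rewrite [s * r]mulrC.
Qed.

Lemma sv_gram_swap n (M : 'M[C]_n) j : sv (M *m M ^t*) j = sv (M ^t* *m M) j.
Proof. by rewrite -[M in M *m _]trmxCK !sv_gram sv_adj. Qed.

(** ** The two Ky Fan comparisons *)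

Section Comparison.
Variables (n : nat) (A B F : 'M[C]_n).
Hypotheses (pA : pd A) (pB : pd B).

Let Z := powmx B (1 / 2) *m (F ^t* *m (F *m A *m F ^t*) *m F) *m powmx B (1 / 2).
Let K := powmx B (1 / 2) *m F ^t* *m F *m powmx A (1 / 2).

Let ZE : Z = K *m K ^t*.
Proof.
rewrite /K !adjM !powmx_herm trmxCK !mulmxA.
rewrite -[_ *m powmx A _ *m powmx A _]mulmxA (powmx_half (pd_psd pA)).
by rewrite /Z !mulmxA.
Qed.

Lemma Z_psd : psd Z.
Proof. by rewrite ZE -[K in K *m _]trmxCK; apply: psd_gram. Qed.

Let sv_Z j : sv Z j = sv K j ^+ 2.
Proof. by rewrite ZE sv_gram_swap sv_gram. Qed.

Section Sum.
Variables (I : finType) (pr : I -> 'M[C]_n) (s r : R).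
Hypotheses (prh : forall i, (pr i) ^t* = pr i)
  (prp : forall i, pr i *m pr i = pr i) (pr1 : \sum_i pr i = 1%:M)
  (prF : \sum_i pr i *m (F ^t* *m F) *m pr i = 1%:M)
  (s1 : 1 < s) (r1 : 1 <= r).

Let G := gmean (powmx A s) (powmx B s).
Let S := F *m G *m F ^t*.
Let D := powmx A (- (1 / 2)) *m G *m powmx B (- (1 / 2)).

Hypothesis (prG : forall i, pr i *m G = G *m pr i).

Let pG : pd G. Proof. by apply: gmean_pd; apply: powmx_pd. Qed.

Let M := powmx G (1 / 2) *m (F ^t* *m F) *m powmx G (1 / 2).

Let ME : M = (F *m powmx G (1 / 2)) ^t* *m (F *m powmx G (1 / 2)).
Proof. by rewrite adjM powmx_herm /M !mulmxA. Qed.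

Let SE : S = (F *m powmx G (1 / 2)) *m (F *m powmx G (1 / 2)) ^t*.
Proof.
rewrite adjM powmx_herm mulmxA -[_ *m powmx G _ *m powmx G _]mulmxA.
by rewrite (powmx_half (pd_psd pG)).
Qed.

Let sv_M j : sv M j = sv S j.
Proof. by rewrite ME SE sv_gram_swap. Qed.

Let psd_S : psd S.
Proof. by rewrite SE -[X in X *m _]trmxCK; apply: psd_gram. Qed.

(** [G] is the pinching of [M] by the projections [pr i], since these commute
    with [G] and pinch [F^*] [F] to the identity. *)
Let sum_sv_G k : (k <= n)%N -> \sum_(j < k) sv G j <= \sum_(j < k) sv S j.
Proof.
move=> kn; have e : \sum_(j < k) sv M j = \sum_(j < k) sv S j.
  by apply: eq_bigr => j _; exact: sv_M.
rewrite -[leRHS]e.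
apply: (sum_sv_pinching kn (pd_psd pG) _ prh prp pr1).
  by rewrite ME; apply: psd_gram.
have prG2 i : pr i *m powmx G (1 / 2) = powmx G (1 / 2) *m pr i.
  apply/esym/powmx_intertwine; [exact: pG.1|exact: pG.1|exact/esym/prG].
transitivity (powmx G (1 / 2) *m
    (\sum_i pr i *m (F ^t* *m F) *m pr i) *m powmx G (1 / 2)).
  by rewrite prF mulmx1 (powmx_half (pd_psd pG)).
rewrite mulmx_sumr mulmx_suml; apply: eq_bigr => i _.
by rewrite /M !mulmxA prG2 -!mulmxA prG2.
Qed.

Let sum_powR_sv_G k : (k <= n)%N ->
  \sum_(j < k) sv G j `^ r <= \sum_(j < k) sv S j `^ r.
Proof.
move=> kn.
apply: (@sum_powR_le _ _ _ k r (@sv_dec _ _ G) (sv_ge0 G) (sv_ge0 S) r1).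
by move=> l lk; apply: sum_sv_G; apply: leq_trans kn.
Qed.

(** Peel [A^(1/2)] and [B^(1/2)] off [G] on the two sides: what remains is
    [D], and moving the left factor [F A^(1/2)] of [S] to the far right turns
    [S] into [D K]. *)
Let prodsv_S k : (k <= n)%N -> prodsv k S <= prodsv k D * prodsv k K.
Proof.
move=> kn; have AA : powmx A (1 / 2) *m powmx A (- (1 / 2)) = 1%:M.
  by rewrite (powmxD_pd _ _ pA) subrr powmx0.
have BB : powmx B (- (1 / 2)) *m powmx B (1 / 2) = 1%:M.
  by rewrite (powmxD_pd _ _ pB) addNr powmx0.
have E : S = (F *m powmx A (1 / 2)) *m (D *m powmx B (1 / 2) *m F ^t*).
  rewrite /S /D !mulmxA -[_ *m powmx A (1 / 2) *m _]mulmxA AA mulmx1.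
  by rewrite -[_ *m powmx B _ *m powmx B _]mulmxA BB mulmx1.
have pE := psd_S; rewrite E in pE *.
apply: le_trans (prodsv_cyclic kn pE) _.
have -> : D *m powmx B (1 / 2) *m F ^t* *m (F *m powmx A (1 / 2)) = D *m K.
  by rewrite /K !mulmxA.
exact: prodsvM.
Qed.

(** The estimate of [S] by [D] and [K] bounds [D] by [G] again and [G] by [S];
    Young's inequality lets [S] absorb its own contribution. *)
Let sum_sv_S k : (k <= n)%N ->
  \sum_(j < k) sv S j `^ r <= \sum_(j < k) sv K j `^ (s * r).
Proof.
move=> kn; have s0 : 0 < s by apply: lt_trans s1.
have r0 : 0 < r by apply: lt_le_trans r1.
have s10 : 0 < s - 1 by rewrite subr_gt0.
have hS : \sum_(j < k) sv S j `^ r <= \sum_(j < k) (sv D j * sv K j) `^ r.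
  apply: (@sum_powR_le_of_prod_le _ (sv S) (fun j => sv D j * sv K j)).
  - exact: sv_dec.
  - exact: sv_ge0.
  - by move=> j; rewrite mulr_ge0 ?sv_ge0.
  - exact: ltW.
  - move=> l lk; rewrite big_split /=; apply: prodsv_S.
    exact: leq_trans kn.
have hD : \sum_(j < k) sv D j `^ (r * s / (s - 1)) <= \sum_(j < k) sv G j `^ r.
  have e : \sum_(j < k) sv G j `^ r =
      \sum_(j < k) (sv G j `^ ((s - 1) / s)) `^ (r * s / (s - 1)).
    apply: eq_bigr => j _; rewrite -powRrM; congr (_ `^ _).
    by field; rewrite !gt_eqF.
  rewrite [leRHS]e.
  apply: (@sum_powR_le_of_prod_le _ (sv D) (fun j => sv G j `^ ((s - 1) / s))).
  - exact: sv_dec.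
  - exact: sv_ge0.
  - by move=> j; apply: powR_ge0.
  - by rewrite divr_ge0 ?mulr_ge0 ?ltW.
  - move=> l lk; rewrite prod_powR; last by move=> j; apply: sv_ge0.
    exact: (prodsv_gmean_factor pA pB (ltW s1) (leq_trans lk kn)).
have hG := sum_powR_sv_G kn.
have young : s * \sum_(j < k) (sv D j * sv K j) `^ r <=
    (s - 1) * \sum_(j < k) sv D j `^ (r * s / (s - 1)) +
    \sum_(j < k) sv K j `^ (s * r).
  rewrite !mulr_sumr -big_split /=; apply: ler_sum => j _.
  exact: young_prod (sv_ge0 D j) (sv_ge0 K j) s1.
apply: (@absorb s).
apply: le_trans (ler_wpM2l (ltW s0) hS) _; apply: le_trans young _.
rewrite lerD2r; apply: ler_wpM2l; first exact: ltW.
exact: le_trans hG.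
Qed.

(** The same absorption, with [G] split as [G^(1/2) G^(r-1) G^(1/2)], takes
    the power [r] out of the sum. *)
Let sum_sv_powG k : (k <= n)%N ->
  \sum_(j < k) sv (F *m powmx G r *m F ^t*) j <= \sum_(j < k) sv S j `^ r.
Proof.
move=> kn; have r0 : 0 < r by apply: lt_le_trans r1.
have r10 : 0 <= r - 1 by rewrite subr_ge0.
have E : F *m powmx G r *m F ^t* = (F *m powmx G (1 / 2)) *m
    (powmx G (r - 1) *m powmx G (1 / 2) *m F ^t*).
  rewrite !mulmxA -[_ *m powmx G (1 / 2) *m powmx G (r - 1)]mulmxA.
  rewrite (powmxD_pd _ _ pG) -[_ *m powmx G _ *m powmx G _]mulmxA.
  rewrite (powmxD_pd _ _ pG).
  by have -> : 1 / 2 + (r - 1) + 1 / 2 = r by lra.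
have pE : psd (F *m powmx G r *m F ^t*).
  rewrite -[F in F *m powmx _ _]trmxCK; apply: psd_congr; exact: powmx_psd.
have h1 : \sum_(j < k) sv (F *m powmx G r *m F ^t*) j <=
    \sum_(j < k) sv G j `^ (r - 1) * sv S j.
  apply: (@sum_le_of_prod_le _ (sv (F *m powmx G r *m F ^t*)) (fun j => sv G j `^ (r - 1) * sv S j)).
  - exact: sv_dec.
  - exact: sv_ge0.
  - by move=> j; rewrite mulr_ge0 ?powR_ge0 ?sv_ge0.
  - move=> l lk; have ln := leq_trans lk kn.
    rewrite big_split /= prod_powR; last by move=> j; apply: sv_ge0.
    rewrite -[leLHS]prodsvE -[X in _ * X]prodsvE -[X in X `^ _]prodsvE.
    rewrite -(prodsv_powmx (pd_psd pG) r10 ln).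
    have <- : prodsv l M = prodsv l S by apply: eq_prodsv => j; exact: sv_M.
    rewrite E; rewrite E in pE.
    apply: le_trans (prodsv_cyclic ln pE) _.
    have -> : powmx G (r - 1) *m powmx G (1 / 2) *m F ^t* *m
        (F *m powmx G (1 / 2)) = powmx G (r - 1) *m M by rewrite /M !mulmxA.
    exact: prodsvM.
have hG := sum_powR_sv_G kn.
have young : r * \sum_(j < k) sv G j `^ (r - 1) * sv S j <=
    (r - 1) * \sum_(j < k) sv G j `^ r + \sum_(j < k) sv S j `^ r.
  rewrite !mulr_sumr -big_split /=; apply: ler_sum => j _.
  by apply: young_powR r1; apply: sv_ge0.
rewrite -(ler_pM2l r0); apply: le_trans (ler_wpM2l (ltW r0) h1) _.
apply: le_trans young _; exact: absorb_le r1 hG.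
Qed.

Lemma sum_sv_geomean k : (k <= n)%N ->
  \sum_(j < k) sv (F *m powmx G r *m F ^t*) j <=
  \sum_(j < k) sv (powmx Z (s * r / 2)) j.
Proof.
move=> kn; apply: le_trans (sum_sv_powG kn) _; apply: le_trans (sum_sv_S kn) _.
rewrite le_eqVlt; apply/orP; left; apply/eqP; apply: eq_bigr => j _.
have sr0 : 0 <= s * r / 2.
  by rewrite divr_ge0// mulr_ge0// ltW//; [apply: lt_trans s1|apply: lt_le_trans r1].
rewrite (sv_powmx Z_psd sr0 (leq_trans (ltn_ord j) kn)) sv_Z.
rewrite -(powR_mulrn 2 (sv_ge0 _ _)) -powRrM; congr (_ `^ _).
by lra.
Qed.

End Sum.

Section Product.
Variables (s r p : R).
Hypotheses (s2 : 2 <= s) (p0 : 0 < p) (r1 : 1 <= r) (rp1 : 1 <= r * p).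

Let P := F *m A *m F ^t*.
Let Q := F *m B *m F ^t*.
Let q := s * r * p / 2.

Let pP : psd P.
Proof.
by rewrite /P -[F in F *m A]trmxCK; apply: psd_congr; apply: pd_psd.
Qed.

Let pQ : psd Q.
Proof.
by rewrite /Q -[F in F *m B]trmxCK; apply: psd_congr; apply: pd_psd.
Qed.

Let sv_gram_half t : 0 <= t -> forall j,
  sv (powmx P t *m powmx Q (2 * t) *m powmx P t) j =
  sv (powmx P t *m powmx Q t) j ^+ 2.
Proof.
move=> t0 j; rewrite -sv_gram -sv_gram_swap adjM !powmx_herm !mulmxA.
by rewrite -[_ *m powmx Q t *m powmx Q t]mulmxA (powmx_double pQ t0).
Qed.

(** [Z] is [T^* T] and [P^(1/2) Q P^(1/2)] is [T T^*] for
    [T = P^(1/2) F B^(1/2)]. *)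
Let sv_Z_product j : sv Z j = sv (powmx P (1 / 2) *m powmx Q (1 / 2)) j ^+ 2.
Proof.
have h0 : 0 <= 1 / 2 :> R by lra.
have h1 : 2 * (1 / 2) = 1 :> R by lra.
rewrite -(sv_gram_half h0) h1 (powmx1 pQ).
pose T := powmx P (1 / 2) *m F *m powmx B (1 / 2).
have -> : Z = T ^t* *m T.
  rewrite /T !adjM !powmx_herm !mulmxA.
  rewrite -[_ *m powmx P _ *m powmx P _]mulmxA (powmx_half pP).
  by rewrite /Z -/P !mulmxA.
rewrite -sv_gram_swap; congr (sv _ j).
rewrite /T !adjM !powmx_herm !mulmxA.
by rewrite -[_ *m powmx B _ *m powmx B _]mulmxA (powmx_half (pd_psd pB)).
Qed.

Lemma sum_sv_araki k : (k <= n)%N ->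
  \sum_(j < k) sv (powmx Z (s * r / 2)) j <=
  \sum_(j < k) sv (powmx (powmx P (s * r * p / 4) *m powmx Q (s * r * p / 2)
                          *m powmx P (s * r * p / 4)) (1 / p)) j.
Proof.
move=> kn; have srp : 2 <= s * r * p.
  by rewrite -mulrA -[leLHS]mulr1; apply: ler_pM.
have q1 : 1 <= q by rewrite /q ler_pdivlMr// mul1r.
have q0 : 0 < q by apply: lt_le_trans q1.
have t0 : 0 <= s * r * p / 4 by rewrite divr_ge0//; lra.
have t2 : s * r * p / 2 = 2 * (s * r * p / 4) by field.
have s0 : 0 < s by apply: lt_le_trans s2.
have r0 : 0 < r by apply: lt_le_trans r1.
have sr0 : 0 < s * r by rewrite mulr_gt0.
pose w := sv (powmx P (1 / 2) *m powmx Q (1 / 2)).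
pose z := sv (powmx P (s * r * p / 4) *m powmx Q (s * r * p / 4)).
have pY : psd (powmx P (s * r * p / 4) *m powmx Q (s * r * p / 2)
               *m powmx P (s * r * p / 4)).
  rewrite -[X in X *m _ *m _](powmx_herm P); apply: psd_congr.
  exact: powmx_psd.
have ip0 : 0 <= 1 / p by rewrite divr_ge0// ltW.
have sr20 : 0 <= s * r / 2 by rewrite divr_ge0// ltW.
have lhs (j : 'I_k) : sv (powmx Z (s * r / 2)) j = w j `^ (s * r).
  rewrite (sv_powmx Z_psd sr20 (leq_trans (ltn_ord j) kn)) sv_Z_product.
  rewrite -(powR_mulrn 2 (sv_ge0 _ _)) -powRrM; congr (_ `^ _).
  by lra.
have rhs (j : 'I_k) : sv (powmx (powmx P (s * r * p / 4) *m
    powmx Q (s * r * p / 2) *m powmx P (s * r * p / 4)) (1 / p)) j =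
    (z j `^ q^-1) `^ (s * r).
  rewrite (sv_powmx pY ip0 (leq_trans (ltn_ord j) kn)) t2 (sv_gram_half t0).
  rewrite -(powR_mulrn 2 (sv_ge0 _ _)) -!powRrM; congr (_ `^ _).
  by rewrite /q; field; rewrite !gt_eqF.
have sumL := eq_bigr _ (fun j (_ : true) => lhs j).
have sumR := eq_bigr _ (fun j (_ : true) => rhs j).
rewrite [leLHS]sumL [leRHS]sumR.
apply: (@sum_powR_le_of_prod_le _ w (fun j => z j `^ q^-1)).
- exact: sv_dec.
- exact: sv_ge0.
- by move=> j; apply: powR_ge0.
- exact: ltW.
- move=> l lk; have ln := leq_trans lk kn.
  rewrite prod_powR; last by move=> j; apply: sv_ge0.
  have q01 : 0 <= q^-1 <= 1 by rewrite invr_ge0 (ltW q0) invf_le1.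
  have := araki_cordes (powmx_psd P (s * r * p / 4))
    (powmx_psd Q (s * r * p / 4)) ln q01.
  rewrite !powmxM; have -> // : s * r * p / 4 / q = 1 / 2.
  by rewrite /q; field; rewrite !gt_eqF.
Qed.

End Product.
End Comparison.
End GeometricMean.

(** * Block matrices *)

Section Blocks.
Variables (R : realType) (m n : nat).
Local Notation C := R[i].
Local Notation L := (\sum_(i < m) n)%N.
Local Opaque determinant mxcalc prodsv sv.

Definition emb (i : 'I_m) : 'M[C]_(L, n) :=
  \mxcol_(j < m) (if j == i then 1%:M else 0 : 'M[C]_n).

Lemma emb_adj i : (emb i) ^t* = \mxrow_(j < m) (if j == i then 1%:M else 0 : 'M[C]_n).
Proof.
apply/matrixP => a b; rewrite !mxE /=; case: ifP => _; rewrite !mxE ?rmorph0//.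
by rewrite rmorph_nat eq_sym.
Qed.

Lemma emb_ortho i j : (emb i) ^t* *m emb j = if i == j then 1%:M else 0.
Proof.
rewrite emb_adj mul_mxrow_mxcol (bigD1 i)//= eqxx mul1mx.
by rewrite big1 ?addr0// => l /negPf ->; rewrite mul0mx.
Qed.

Lemma mxblock_emb (X : 'I_m -> 'I_m -> 'M[C]_n) :
  \mxblock_(i < m, j < m) X i j = \sum_i \sum_j emb i *m X i j *m (emb j) ^t*.
Proof.
apply/mxblockP => a b; rewrite mxblockK submxblock_sum.
rewrite (bigD1 a)//= [X in _ + X]big1 ?addr0 => [|i ia]; last first.
  rewrite submxblock_sum big1// => j _.
  rewrite emb_adj /emb mxcol_mul mul_mxcol_mxrow mxblockK.
  by rewrite eq_sym (negPf ia) !mul0mx.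
rewrite submxblock_sum (bigD1 b)//= [X in _ + X]big1 ?addr0 => [|j jb]; last first.
  rewrite emb_adj /emb mxcol_mul mul_mxcol_mxrow mxblockK.
  by rewrite [b == j]eq_sym (negPf jb) mulmx0.
by rewrite emb_adj /emb mxcol_mul mul_mxcol_mxrow mxblockK !eqxx mul1mx mulmx1.
Qed.

Lemma sum_emb : \sum_i emb i *m (emb i) ^t* = 1%:M.
Proof.
rewrite -mxdiagZ /mxdiag mxblock_emb; apply: eq_bigr => i _.
rewrite [RHS](bigD1 i)//= [X in _ + X]big1 ?addr0 => [|j ji].
  by rewrite eqxx conform_mx_id mulmx1.
by rewrite eq_sym (negPf ji) mulmx0 mul0mx.
Qed.

Definition bdiag (X : 'I_m -> 'M[C]_n) : 'M[C]_L :=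
  \sum_i emb i *m X i *m (emb i) ^t*.

Lemma bdiag_emb X i : bdiag X *m emb i = emb i *m X i.
Proof.
rewrite mulmx_suml [LHS](bigD1 i)//= [X in _ + X]big1 ?addr0 => [|j ji].
  by rewrite -mulmxA emb_ortho eqxx mulmx1.
by rewrite -mulmxA emb_ortho (negPf ji) mulmx0.
Qed.

Lemma emb_ext (Y : 'M[C]_L) X : (forall i, Y *m emb i = emb i *m X i) ->
  Y = bdiag X.
Proof.
move=> H; rewrite -[Y]mulmx1 -sum_emb mulmx_sumr; apply: eq_bigr => i _.
by rewrite mulmxA H.
Qed.

Lemma bdiagM X Y : bdiag X *m bdiag Y = bdiag (fun i => X i *m Y i).
Proof.
by apply: emb_ext => i; rewrite -mulmxA bdiag_emb mulmxA bdiag_emb mulmxA.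
Qed.

Lemma eq_bdiag X Y : X =1 Y -> bdiag X = bdiag Y.
Proof. by move=> XY; apply: eq_bigr => i _; rewrite XY. Qed.

Lemma bdiag1 : bdiag (fun=> 1%:M) = 1%:M.
Proof. by rewrite -sum_emb; apply: eq_bigr => i _; rewrite mulmx1. Qed.

Lemma bdiag_adj X : (bdiag X) ^t* = bdiag (fun i => (X i) ^t*).
Proof.
rewrite /bdiag raddf_sum raddf_sum /=; apply: eq_bigr => i _.
by rewrite !adjM trmxCK mulmxA.
Qed.

Lemma bdiag_pd X : (forall i, pd (X i)) -> pd (bdiag X).
Proof.
move=> pX; have -> : bdiag X = (bdiag (fun i => powmx (X i) (1 / 2))) ^t* *m
    bdiag (fun i => powmx (X i) (1 / 2)).
  rewrite bdiag_adj bdiagM; apply: eq_bdiag => i.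
  by rewrite powmx_herm (powmx_half (pd_psd (pX i))).
apply: pd_gram.
have : bdiag (fun i => powmx (X i) (1 / 2)) *m
    bdiag (fun i => powmx (X i) (- (1 / 2))) = 1%:M.
  rewrite bdiagM -bdiag1; apply: eq_bdiag => i.
  by rewrite (powmxD_pd _ _ (pX i)) subrr powmx0.
by move=> /mulmx1_unit[u _]; exact: u.
Qed.

Lemma bdiag_powmx X t : (forall i, (X i) ^t* = X i) ->
  powmx (bdiag X) t = bdiag (fun i => powmx (X i) t).
Proof.
move=> hX; apply: emb_ext => i; apply: powmx_intertwine; last exact: bdiag_emb.
  by rewrite bdiag_adj; apply: eq_bdiag.
exact: hX.
Qed.

Lemma bdiag_gmean X Y : (forall i, pd (X i)) -> (forall i, pd (Y i)) ->
  gmean (bdiag X) (bdiag Y) = bdiag (fun i => gmean (X i) (Y i)).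
Proof.
move=> pX pY; have hX i : (X i) ^t* = X i by case: (pX i).
rewrite /gmean !(bdiag_powmx _ hX) !bdiagM bdiag_powmx ?bdiagM// => i.
by rewrite !adjM powmx_herm (pY i).1 mulmxA.
Qed.

(** ** Summing the diagonal blocks *)

Variable i0 : 'I_m.
Hypothesis i00 : val i0 = 0%N.

(** First block row all identities: [rowsum] compresses a block diagonal
    matrix to the sum of its blocks, placed in the first block. *)
Definition rowsum : 'M[C]_L := \sum_i emb i0 *m (emb i) ^t*.

Lemma rowsum_emb i : rowsum *m emb i = emb i0.
Proof.
rewrite mulmx_suml [LHS](bigD1 i)//= [X in _ + X]big1 ?addr0 => [|j ji].
  by rewrite -mulmxA emb_ortho eqxx mulmx1.
by rewrite -mulmxA emb_ortho (negPf ji) mulmx0.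
Qed.

Lemma pad0E (X : 'M[C]_n) : pad0 m X = emb i0 *m X *m (emb i0) ^t*.
Proof.
have z (j : 'I_m) : (val j == 0%N) = (j == i0) by rewrite -i00.
rewrite /pad0 mxblock_emb [LHS](bigD1 i0)//= [X in _ + X]big1 ?addr0.
  rewrite [LHS](bigD1 i0)//= [X in _ + X]big1 ?addr0 => [|j ji].
    by rewrite !z eqxx.
  by rewrite !z (negPf ji) andbF mulmx0 mul0mx.
move=> i ii0; apply: big1 => j _.
by rewrite !z (negPf ii0) mulmx0 mul0mx.
Qed.

Lemma adj_rowsum : rowsum ^t* = \sum_i emb i *m (emb i0) ^t*.
Proof.
rewrite /rowsum raddf_sum raddf_sum /=; apply: eq_bigr => i _.
by rewrite adjM trmxCK.
Qed.

Lemma rowsum_bdiag X : rowsum *m bdiag X *m rowsum ^t* = pad0 m (\sum_i X i).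
Proof.
rewrite pad0E adj_rowsum [RHS](_ : _ = \sum_i emb i0 *m X i *m (emb i0) ^t*).
  rewrite [LHS]mulmx_sumr; apply: eq_bigr => i _.
  by rewrite mulmxA -[_ *m _ *m emb i]mulmxA bdiag_emb mulmxA rowsum_emb.
by rewrite [X in X *m _]mulmx_sumr mulmx_suml.
Qed.

Lemma pad0M (X Y : 'M[C]_n) : pad0 m X *m pad0 m Y = pad0 m (X *m Y).
Proof.
by rewrite !pad0E !mulmxA -[_ *m _ *m emb i0]mulmxA emb_ortho eqxx mulmx1.
Qed.

(** [t != 0], since the padding zeros must be sent to 0. *)
Lemma pad0_powmx (X : 'M[C]_n) t : X ^t* = X -> t != 0 ->
  powmx (pad0 m X) t = pad0 m (powmx X t).
Proof.
move=> hX t0.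
have h0 : (0 : 'M[C]_n) ^t* = 0 by rewrite trmx0 map_mx0.
have P0 : powmx (0 : 'M[C]_n) t = 0.
  have e0 j : evals (0 : 'M[C]_n) j = 0.
    by apply: complexI; rewrite evalsE// mulmx0 mul0mx mxE.
  rewrite powmx.unlock /mxpowR mxcalcE.
  have -> : rdiag ((fun x => x `^ t) \o evals (0 : 'M[C]_n)) = 0.
    by apply/matrixP => a b; rewrite rdiagE /= e0 powR0// mul0rn mxE.
  by rewrite mulmx0 mul0mx.
pose X' (i : 'I_m) := if i == i0 then X else 0 : 'M[C]_n.
have padE (Y : 'M[C]_n) : pad0 m Y = bdiag (fun i => if i == i0 then Y else 0).
  rewrite pad0E /bdiag [RHS](bigD1 i0)//= eqxx [X in _ + X]big1 ?addr0// => i /negPf ->.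
  by rewrite mulmx0 mul0mx.
rewrite !padE bdiag_powmx => [|i]; last by case: ifP.
by apply: eq_bdiag => i; case: ifP.
Qed.

Lemma blockZ_rowsum (A B : 'I_m -> 'M[C]_n) : (forall i, pd (B i)) ->
  blockZ A B = powmx (bdiag B) (1 / 2) *m
   (rowsum ^t* *m (rowsum *m bdiag A *m rowsum ^t*) *m rowsum) *m
   powmx (bdiag B) (1 / 2).
Proof.
move=> pB; have hB i : (B i) ^t* = B i by case: (pB i).
rewrite rowsum_bdiag (bdiag_powmx _ hB) /blockZ mxblock_emb pad0E.
set S := \sum_k A k.
have sE : rowsum ^t* *m emb i0 = \sum_i emb i.
  rewrite adj_rowsum mulmx_suml; apply: eq_bigr => i _.
  by rewrite -mulmxA emb_ortho eqxx mulmx1.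
have sE' : (emb i0) ^t* *m rowsum = \sum_i (emb i) ^t*.
  rewrite /rowsum mulmx_sumr; apply: eq_bigr => i _.
  by rewrite mulmxA emb_ortho eqxx mul1mx.
rewrite !mulmxA -[_ *m rowsum ^t* *m emb i0]mulmxA sE.
rewrite -[_ *m (emb i0) ^t* *m rowsum]mulmxA sE'.
have l1 : bdiag (fun i => powmx (B i) (1 / 2)) *m (\sum_i emb i) =
    \sum_i emb i *m powmx (B i) (1 / 2).
  by rewrite mulmx_sumr; apply: eq_bigr => i _; rewrite bdiag_emb.
have l2 : (\sum_i (emb i) ^t*) *m bdiag (fun i => powmx (B i) (1 / 2)) =
    \sum_i powmx (B i) (1 / 2) *m (emb i) ^t*.
  rewrite mulmx_suml; apply: eq_bigr => i _.
  rewrite -[LHS]trmxCK adjM trmxCK bdiag_adj.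
  rewrite (eq_bdiag (fun i => powmx_herm (B i) (1 / 2))) bdiag_emb.
  by rewrite adjM powmx_herm.
rewrite l1 -[RHS]mulmxA l2 [X in _ = X *m _]mulmx_suml [RHS]mulmx_suml.
apply: eq_bigr => i _; rewrite [RHS]mulmx_sumr; apply: eq_bigr => j _.
by rewrite powmx.unlock !mulmxA.
Qed.

Definition bproj (i : 'I_m) : 'M[C]_L := emb i *m (emb i) ^t*.

Lemma bproj_herm i : (bproj i) ^t* = bproj i.
Proof. by rewrite adjM trmxCK. Qed.

Lemma bproj_idem i : bproj i *m bproj i = bproj i.
Proof.
by rewrite /bproj mulmxA -[_ *m _ *m emb i]mulmxA emb_ortho eqxx mulmx1.
Qed.

Lemma bproj_bdiag i X : bproj i *m bdiag X = bdiag X *m bproj i.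
Proof.
have -> : bproj i = bdiag (fun j => if j == i then 1%:M else 0).
  rewrite /bdiag [RHS](bigD1 i)//= eqxx mulmx1 [X in _ + X]big1 ?addr0// => j /negPf ->.
  by rewrite mulmx0 mul0mx.
rewrite !bdiagM; apply: eq_bdiag => j.
by case: ifP; rewrite ?mul1mx ?mulmx1 ?mul0mx ?mulmx0.
Qed.

Lemma bproj_rowsum : \sum_i bproj i *m (rowsum ^t* *m rowsum) *m bproj i = 1%:M.
Proof.
rewrite -sum_emb; apply: eq_bigr => i _; rewrite /bproj.
have e : (emb i) ^t* *m rowsum ^t* = (emb i0) ^t* by rewrite -adjM rowsum_emb.
rewrite !mulmxA -[emb i *m _ *m rowsum ^t*]mulmxA e.
rewrite -[_ *m rowsum *m emb i]mulmxA rowsum_emb.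
by rewrite -[_ *m _ *m emb i0]mulmxA emb_ortho eqxx mulmx1.
Qed.

End Blocks.

(** * The norm inequalities *)

Theorem theorem3p6 (R : realType) (m n : nat) (hm : (1 <= m)%N) (hn : (1 <= n)%N)
    (A B : 'I_m -> 'M[R[i]]_n)
    (hA : forall i, posdefmx (A i)) (hB : forall i, posdefmx (B i))
    (p r : R) (hp : 0 < p) (hr : 1 <= r) (hrp : 1 <= r * p)
    (N : 'M[R[i]]_(\sum_(i < m) n) -> R) (hN : unitarily_invariant_norm N)
    (s : R) (hs : 2 <= s) :
  N (pad0 m (\sum_(i < m) mxpowR (geomean (mxpowR (A i) s) (mxpowR (B i) s)) r))
    <= N (mxpowR (blockZ A B) (s * r / 2))
  /\
  N (mxpowR (blockZ A B) (s * r / 2))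
    <= N (pad0 m (mxpowR
         (mxpowR (\sum_(i < m) A i) (s * r * p / 4)
            *m mxpowR (\sum_(i < m) B i) (s * r * p / 2)
            *m mxpowR (\sum_(i < m) A i) (s * r * p / 4))
         (1 / p))).
Proof.
have pA i : pd (A i) by exact: posdefmx_pd.
have pB i : pd (B i) by exact: posdefmx_pd.
have hA' i : (A i) ^t* = A i by case: (pA i).
have hB' i : (B i) ^t* = B i by case: (pB i).
pose i0 : 'I_m := Ordinal hm.
have powE k (H : 'M[R[i]]_k) t : mxpowR H t = powmx H t by rewrite powmx.unlock.
have pAA := bdiag_pd pA; have pBB := bdiag_pd pB.
have s1 : 1 < s by apply: lt_le_trans hs; rewrite ltr1n.
have s0 : 0 < s by apply: lt_le_trans hs.
have r0 : 0 < r by apply: lt_le_trans hr.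
have Gblock : gmean (powmx (bdiag A) s) (powmx (bdiag B) s) =
    bdiag (fun i => gmean (powmx (A i) s) (powmx (B i) s)).
  rewrite !bdiag_powmx// bdiag_gmean// => i; exact: powmx_pd.
have gpd i : pd (gmean (powmx (A i) s) (powmx (B i) s)).
  by apply: gmean_pd; apply: powmx_pd.
have ZE := @blockZ_rowsum R m n i0 erefl A B pB.
split.
  rewrite powE ZE.
  have -> : pad0 m (\sum_(i < m) mxpowR (geomean (mxpowR (A i) s)
      (mxpowR (B i) s)) r) =
    rowsum R n i0 *m powmx (gmean (powmx (bdiag A) s) (powmx (bdiag B) s)) r
      *m (rowsum R n i0) ^t*.
    rewrite Gblock bdiag_powmx => [|i]; last by case: (gpd i).
    rewrite (rowsum_bdiag (i0 := i0))//; congr pad0; apply: eq_bigr => i _.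
    by rewrite !powE gmeanE.
  apply: (uinorm_dominance hN).
  - rewrite -[X in psd (X *m _ *m _)]trmxCK; apply: psd_congr.
    exact: powmx_psd.
  - exact: powmx_psd.
  - move=> k kL; apply: (sum_sv_geomean pAA pBB (@bproj_herm R m n)
      (@bproj_idem R m n) (sum_emb R m n) (bproj_rowsum _ _ i0) s1 hr _ kL).
    by move=> i; rewrite Gblock; apply: bproj_bdiag.
rewrite !powE ZE.
have srp0 : 0 < s * r * p by rewrite !mulr_gt0.
have padP (X : 'I_m -> 'M[R[i]]_n) t : (forall i, (X i) ^t* = X i) -> t != 0 ->
    pad0 m (powmx (\sum_i X i) t) =
    powmx (rowsum R n i0 *m bdiag X *m (rowsum R n i0) ^t*) t.
  move=> hX t0; rewrite (rowsum_bdiag (i0 := i0))// (pad0_powmx (i0 := i0))//.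
  by rewrite raddf_sum raddf_sum; apply: eq_bigr => i _; apply: hX.
rewrite -(pad0_powmx (i0 := i0))//; last by rewrite div1r invr_eq0 gt_eqF.
  rewrite -!(pad0M (i0 := i0))// !padP// ?mulf_neq0 ?gt_eqF ?invr_gt0//.
  apply: (uinorm_dominance hN); [exact: powmx_psd|exact: powmx_psd|].
  by move=> k kL; apply: sum_sv_araki.
by rewrite !adjM !powmx_herm mulmxA.
Qed.
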